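(* Suppose $\tilde X_n$ is an $n\times p$ random matrix whose rows are i.i.d. $\mathcal N(0,\tilde\Sigma_n)$, where the $p\times p$ covariance matrices $\tilde\Sigma_n$ satisfy $$c_m\le \inf_{n\ge1}\lambda_{\min}(\tilde\Sigma_n)\le\sup_{n\ge1}\lambda_{\max}(\tilde\Sigma_n)\le c_M$$ for some universal constants $0<c_m\le c_M<\infty$. Then the following hold. (i) (Wide-matrix regime) If $p/n\to\gamma\in(1,\infty)$ as $n\to\infty$, then for any fixed $r\ge0$ there exists a constant $K_1^{\mathrm{row}}(r)>0$ such that $$\mathbb E\big[\{\kappa(\tilde X_n)\}^r\big]\le K_1^{\mathrm{row}}(r)$$ for all $n$. (ii) (Critical regime) If $p/n\to1$ as $n\to\infty$, then for every fixed $r>0$, $$\mathbb E\big[\{\kappa(\tilde X_n)\}^r\big]\to\infty\quad\text{as }n\to\infty.$$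
   Context: The dimension $p=p_n$ may depend on $n$. For $A\in\mathbb R^{n\times p}$, $s_{\max}(A)$ is the largest singular value and $s_{\min}(A)$ is the $\min(n,p)$-th singular value when the singular values are arranged in descending order; the condition number is $\kappa(A)=s_{\max}(A)/s_{\min}(A)$. Under the stated assumptions $\tilde X_n$ has rank $\min(n,p)$ almost surely, so $s_{\min}(\tilde X_n)$ is its smallest nonzero singular value. $\lambda_{\min},\lambda_{\max}$ denote the smallest and largest eigenvalues of a symmetric matrix.
   Formalization: In (i), ''for all n'' is replaced by ''for all sufficiently large n'': the limit of p/n does not constrain small n, where the r-th moment of the condition number can be infinite (e.g. n = p = 2, r ≥ 1). *)

(* Defs.v *)
From HB Require Import structures.
From mathcomp Require Import all_boot all_order all_algebra.
From mathcomp Require Import polyrcf.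
From mathcomp Require Import all_classical all_reals all_analysis.

Set Implicit Arguments.
Unset Strict Implicit.
Unset Printing Implicit Defensive.

Import Order.TTheory GRing.Theory Num.Theory.
Import numFieldNormedType.Exports.

Local Open Scope classical_set_scope.
Local Open Scope ring_scope.

Section Spectrum.
Context {R : realType}.

(* The real eigenvalues of S, repeated according to their algebraic
   multiplicity, in descending order. When S is symmetric of size m, all
   eigenvalues are real and this list has length m. *)
Definition spectrum m (S : 'M[R]_m) : seq R :=
  sort >=%R (flatten [seq nseq (mup x (char_poly S)) x | x <- rootsR (char_poly S)]).

Definition lambda_max m (S : 'M[R]_m) : R := head 0 (spectrum S).

Definition lambda_min m (S : 'M[R]_m) : R := last 0 (spectrum S).

(* All p singular values of an n x p matrix, in descending order; when n < p
   the last p - n of them are zero. *)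
Definition singular_values n p (A : 'M[R]_(n, p)) : seq R :=
  [seq Num.sqrt x | x <- spectrum (A^T *m A)].

Definition s_max n p (A : 'M[R]_(n, p)) : R := nth 0 (singular_values A) 0.

(* The minn n p-th singular value, positions being counted from 0 by nth. *)
Definition s_min n p (A : 'M[R]_(n, p)) : R :=
  nth 0 (singular_values A) (minn n p).-1.

(* The division is the one of \bar R, so a nonzero A with s_min A = 0 has
   condition number +oo. *)
Definition condition_number n p (A : 'M[R]_(n, p)) : \bar R :=
  ((s_max A)%:E / (s_min A)%:E)%E.

End Spectrum.

Section Gaussian.
Context d (T : measurableType d) (R : realType) (P : probability T R).

Definition mutually_independent (I : finType) (F : I -> set (set T)) : Prop :=
  forall (J : {set I}) (E : I -> set T),
    (forall i, i \in J -> F i (E i)) ->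
    P (\bigcap_(i in [set` J]) E i) = (\prod_(i in J) P (E i))%E.

(* The coordinates Z j of the random vector Z are i.i.d. N(0, 1). *)
Definition standard_normal_vector p (Z : 'I_p -> {RV P >-> R}) : Prop :=
  (forall j (B : set R), measurable B ->
     distribution P (Z j) B = normal_prob 0 1 B) /\
  mutually_independent (fun j => preimage_set_system setT (Z j) measurable).

(* Y ~ N(0, Sigma): Y = Z A with Z a standard normal row vector and A a square
   root of Sigma, i.e., A^T A = Sigma. Taking A square and Z on the same
   probability space as Y is no restriction for an invertible Sigma, since then
   Z = Y A^-1. *)
Definition multivariate_normal p (Y : T -> 'rV[R]_p) (Sigma : 'M[R]_p) : Prop :=
  exists (A : 'M[R]_p) (Z : 'I_p -> {RV P >-> R}),
    [/\ A^T *m A = Sigma,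
        standard_normal_vector Z &
        forall w, Y w = (\row_j Z j w) *m A].

(* g_sigma_preimage is here the sigma-algebra generated by the i-th row. *)
Definition iid_normal_rows n p (X : T -> 'M[R]_(n, p)) (Sigma : 'M[R]_p) : Prop :=
  (forall i, multivariate_normal (fun w => row i (X w)) Sigma) /\
  mutually_independent
    (fun i : 'I_n => g_sigma_preimage (fun (j : 'I_p) (w : T) => X w i j)).

End Gaussian.

(* Main.v *)
From HB Require Import structures.
Require Import Defs.
From mathcomp Require Import all_boot all_order all_algebra.
From mathcomp Require Import complex polyrcf.
From mathcomp Require Import ring lra zify.
From mathcomp Require Import all_classical all_reals all_analysis.
From mathcomp Require Import measurable_realfun.

(** The singular values enter only through their variational description: for
    a row vector [u], the value [sqnorm (u *m X)] lies above [s_min X ^+ 2 *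
    sqnorm u] when X is wide, and below [s_max X ^+ 2 * sqnorm u] always.

    The i-th row of X is [Z_i A_i] with [A_i^T A_i = Sigma], and all the
    coordinates of all the [Z_i] form one i.i.d. standard normal family
    ([iid_normal_rows_coords]). About such a family a single fact is used:
    replacing one coordinate by an independent standard normal variable
    changes no expectation ([coordinate_fubini]). Integrating the coordinates
    of [u *m X] one after the other turns the Laplace transform of its squared
    norm into a chain of rank-one updates of a quadratic form
    ([integral_expR_qform_lincomb]), hence into a quotient of determinants.
    For unit u this yields two tail bounds with exponent p, up to constants
    [P(|uX|^2 <= rho) <= (rho / p)^(p/2)] ([prob_sqnorm_mul_le]) and
    [P(|uX|^2 >= rho) <= (p / rho)^p] ([prob_sqnorm_mul_ge]).

    (i) Fix a >= 1. A net of the unit sphere with a number of points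
    exponential in n bounds [s_max X] by [a sqrt p]. A net of mesh about
    [a^-q], of [O(a^q)^n] points, then carries the lower bound
    [|vX| >= a^(1-q) sqrt p] from its points v to the whole sphere. The
    failure probability of the second step is [(C a^q)^n (a^(1-q))^p], which
    is at most [(C / a)^p] as soon as [q (p - n) >= 2 p]; a fixed q achieves
    this because p / n stays away from 1. So the condition number is at most
    [2 a^q] off an event of probability [2 (C / a)^p]
    ([condition_number_tail]). Along [a = a0 2^m] the r-th moment is a series
    in which [2^(m q r)] competes with [2^(- m p)], and p exceeds q r for
    large n ([wide_moment_le]).

    (ii) Let C consist of [minn n p - 1] of the rows and let
    [N = tau (tau + C^T C)^-1], a smooth substitute for the orthogonal
    projection onto the kernel of C. Were [s_min X ^+ 2 >= L] with tau small
    compared to L, the rows outside C could not be nearly annihilated by N: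
    the sum of [|X_i N|^2 / |N|_F^2] over them would be at least
    [L / (|p - n| + 2)] or [L / 2] ([leak_wide], [leak_tall]). Those rows
    are independent of N, so each summand has mean at most [8 c_M]
    ([integral_row_leak_le]) and Markov's inequality bounds
    [P(s_min X ^+ 2 >= L)] by [16 c_M (|p - n| + 2) / L] ([s_min_tail]). With
    [L = e n] and [|p - n| = o(n)] this is small for every e > 0, while
    [s_max X ^+ 2 >= |X_0|^2] is of order p; hence the condition number
    exceeds any given bound with probability at least 1/2
    ([critical_moment_ge]).

    The integral of a nonnegative function is a supremum over the simple
    functions below it and is thus monotone for arbitrary functions
    ([ge0_le_integralT]). The condition number is therefore only compared with
    measurable functions. *)

Set Implicit Arguments.
Unset Strict Implicit.
Unset Printing Implicit Defensive.

Import Order.TTheory GRing.Theory Num.Theory.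
Import numFieldNormedType.Exports.

Local Open Scope classical_set_scope.
Local Open Scope ring_scope.

(** * Spectra and singular values *)

(** Sylvester's determinant identity: both sides are the determinant of the
    block matrix [[x, A], [B, 1]], cleared of one off-diagonal block in two ways. *)
Lemma det_scalar_sub_mulmxC (K : comNzRingType) n p (A : 'M[K]_(n, p))
    (B : 'M[K]_(p, n)) (x : K) :
  x ^+ p * \det (x%:M - A *m B) = x ^+ n * \det (x%:M - B *m A).
Proof.
pose M := block_mx x%:M A B 1%:M.
have M1 : M *m block_mx 1%:M 0 (- B) 1%:M = block_mx (x%:M - A *m B) A 0 1%:M.
  rewrite mulmx_block !mulmx1 !mulmx0 !mul1mx !add0r mulmxN.
  by rewrite addrN.
have M2 : block_mx 1%:M 0 (- B) x%:M *m M =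
          block_mx x%:M A 0 (x%:M - B *m A).
  rewrite mulmx_block !mul1mx !mul0mx !addr0 mulNmx mulmx1.
  by rewrite mul_scalar_mx mul_mx_scalar addNr mulNmx addrC.
have dM : \det M = \det (x%:M - A *m B).
  have /(congr1 determinant) := M1.
  by rewrite det_mulmx det_lblock !det1 !mulr1 det_ublock det1 mulr1.
have /(congr1 determinant) := M2.
by rewrite det_mulmx det_lblock det1 mul1r det_scalar dM det_ublock det_scalar.
Qed.

Lemma char_poly_mulmxC (K : comNzRingType) n p (A : 'M[K]_(n, p))
    (B : 'M[K]_(p, n)) :
  'X^p * char_poly (A *m B) = 'X^n * char_poly (B *m A).
Proof. by rewrite /char_poly /char_poly_mx !map_mxM det_scalar_sub_mulmxC. Qed.

Section LinAlg.
Context {R : realType}.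

Definition sqnorm m (u : 'rV[R]_m) : R := \sum_j u 0 j ^+ 2.

Definition qform m (S : 'M[R]_m) (u : 'rV[R]_m) : R := (u *m S *m u^T) 0 0.

Lemma sqnorm_ge0 m (u : 'rV[R]_m) : 0 <= sqnorm u.
Proof. by apply: sumr_ge0 => j _; exact: sqr_ge0. Qed.

Lemma sqnormE m (u : 'rV[R]_m) : sqnorm u = (u *m u^T) 0 0.
Proof. by rewrite mxE; apply: eq_bigr => j _; rewrite mxE expr2. Qed.

Lemma sqnorm_eq0 m (u : 'rV[R]_m) : (sqnorm u == 0) = (u == 0).
Proof.
apply/eqP/eqP => [/eqP|->]; last by rewrite /sqnorm big1// => j _; rewrite mxE expr0n.
rewrite psumr_eq0 => [/allP u0|j _]; last exact: sqr_ge0.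
apply/rowP => j; rewrite mxE; apply/eqP; rewrite -sqrf_eq0.
by apply: u0; rewrite mem_index_enum.
Qed.

Lemma sqnormD_le m (u v : 'rV[R]_m) : sqnorm (u + v) <= 2 * sqnorm u + 2 * sqnorm v.
Proof.
rewrite /sqnorm !mulr_sumr -big_split; apply: ler_sum => j _; rewrite mxE /=.
have := sqr_ge0 (u 0 j - v 0 j); nra.
Qed.

Lemma sqnormN m (u : 'rV[R]_m) : sqnorm (- u) = sqnorm u.
Proof. by apply: eq_bigr => j _; rewrite mxE sqrrN. Qed.

Lemma sqnormZ m a (u : 'rV[R]_m) : sqnorm (a *: u) = a ^+ 2 * sqnorm u.
Proof. by rewrite /sqnorm mulr_sumr; apply: eq_bigr => j _; rewrite mxE exprMn. Qed.

Lemma sqnorm_delta m (i : 'I_m) : sqnorm (delta_mx 0 i : 'rV[R]_m) = 1.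
Proof.
rewrite /sqnorm (bigD1 i)//= big1 => [|j ji]; first by rewrite mxE !eqxx expr1n addr0.
by rewrite mxE (negbTE ji) andbF expr0n.
Qed.

(** A monic polynomial that splits over R determines the multiset of its
    roots, so any factorisation of the characteristic polynomial reveals the
    spectrum. *)
Lemma spectrumE m (S : 'M[R]_m) (s : seq R) :
  char_poly S = \prod_(x <- s) ('X - x%:P) -> spectrum S = sort >=%R s.
Proof.
move=> Ss; rewrite /spectrum; apply/(perm_sortP).
- by move=> x y; exact: le_total.
- by move=> y x z /= yx zy; exact: (le_trans zy yx).
- by move=> x y /= /le_anti.
rewrite Ss; set q := \prod_(x <- s) _.
have q0 : q != 0.
  by rewrite /q prodf_seq_neq0; apply/allP => x _ /=; rewrite polyXsubC_eq0.
apply/allP => x _ /=; apply/eqP; rewrite count_flatten -map_comp.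
rewrite (@eq_map _ _ _ (fun y => (mup x q * (y == x))%N)); last first.
  by move=> y /=; rewrite count_nseq /=; case: eqP => [->|_]; rewrite ?mul0n ?muln0 ?mul1n ?muln1.
rewrite sumnE big_map -big_distrr /= -mu_prod_XsubC -/q.
case: (boolP (root q x)) => qx; last by rewrite mupNroot// mul0n.
have -> : (\sum_(i <- rootsR q) (i == x) = count_mem x (rootsR q))%N.
  by rewrite -sum1_count [RHS]big_mkcond; apply: eq_bigr => i _ /=; case: eqP.
rewrite count_uniq_mem ?uniq_roots// -(roots_on_rootsR q0) inE /= qx.
by rewrite muln1.
Qed.

(** The real symmetric spectral theorem in the weak form needed here, deduced
    from the complex one: [c i] is the squared modulus of the i-th coordinate of u
    in a unitary eigenbasis, which spares the construction of real eigenvectors. *)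
Lemma sym_diagonalization m (S : 'M[R]_m) : S^T = S ->
  exists d : 'I_m -> R, char_poly S = \prod_i ('X - (d i)%:P) /\
    forall u : 'rV[R]_m, exists c : 'I_m -> R,
      [/\ forall i, 0 <= c i, sqnorm u = \sum_i c i &
          qform S u = \sum_i d i * c i].
Proof.
move=> symS; pose f := real_complex R.
pose SC := map_mx f S.
have SCr : SC \is a mxOver Num.real.
  apply/mxOverP => i j; rewrite mxE; apply/CrealP; exact: conjc_real.
have SCs : SC \is symmetricmx.
  by apply/is_hermitianmxP; rewrite expr0 scale1r map_mx_id// /SC map_trmx symS.
have /orthomx_spectralP SCE := symmetric_normalmx SCs SCr.
have /mxOverP Dr := hermitian_spectral_diag_real (realsym_hermsym SCs SCr).
have Pu := spectral_unitarymx SC.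
have Punit := spectral_unit SC.
move: SCE Dr Pu Punit.
move: (spectralmx SC) (spectral_diag SC) => P D SCE Dr Pu Punit.
exists (fun i => complex.Re (D 0 i)).
have DE i : D 0 i = f (complex.Re (D 0 i)) by rewrite /f RRe_real.
split.
  apply: (map_poly_inj f); rewrite map_char_poly -/SC SCE -mulmxA.
  apply: (@mulfI _ ('X^m)); first by rewrite expf_neq0// polyX_eq0.
  rewrite char_poly_mulmxC mulmxK//; congr (_ * _).
  rewrite char_poly_trig ?diag_mx_is_trig// rmorph_prod.
  apply: eq_bigr => i _; rewrite rmorphB /= map_polyX map_polyC /=.
  by rewrite mxE eqxx mulr1n; congr (_ - _%:P); exact: DE.
move=> u; pose uC := map_mx f u.
pose v := uC *m (P ^t* )%sesqui.
have fsum (F : 'I_m -> R) : f (\sum_i F i) = \sum_i f (F i) by exact: rmorph_sum.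
have fr (x : R) : (f x)^* = f x by exact: conjc_real.
have vE i : (P *m uC^T) i 0 = (v 0 i)^*.
  rewrite !mxE rmorph_sum; apply: eq_bigr => j _.
  by rewrite !mxE rmorphM /= conjCK fr mulrC.
have vv i : v 0 i * (v 0 i)^* = f (complex.Re (v 0 i) ^+ 2 + complex.Im (v 0 i) ^+ 2).
  by rewrite /f add_Re2_Im2 normCK.
exists (fun i => complex.Re (v 0 i) ^+ 2 + complex.Im (v 0 i) ^+ 2).
have fI : injective f by exact: fmorph_inj.
split; first by move=> i; rewrite addr_ge0// sqr_ge0.
- apply: fI; rewrite sqnormE fsum.
  transitivity ((v *m (P *m uC^T)) 0 0).
    rewrite /v mulmxA -invmx_unitary// mulmxKV// /uC map_trmx -map_mxM.
    by rewrite [RHS]mxE.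
  by rewrite mxE; apply: eq_bigr => i _; rewrite vE vv.
- apply: fI; rewrite /qform fsum.
  transitivity ((v *m (diag_mx D *m (P *m uC^T))) 0 0).
    rewrite /v -invmx_unitary// !mulmxA -[uC *m _ *m _]mulmxA -[uC *m _ *m P]mulmxA -SCE.
    by rewrite /uC /SC map_trmx -!map_mxM [RHS]mxE.
  rewrite mxE; apply: eq_bigr => i _; rewrite mul_diag_mx [X in _ * X]mxE vE mulrCA vv DE.
  exact/esym/rmorphM.
Qed.

Lemma sorted_ge_spectrum m (S : 'M[R]_m) : sorted >=%R (spectrum S).
Proof. by apply: sort_sorted => x y; exact: le_total. Qed.

Section Symmetric.
Variables (m : nat) (S : 'M[R]_m).
Hypothesis symS : S^T = S.

Lemma char_poly_spectrum :
  char_poly S = \prod_(x <- spectrum S) ('X - x%:P).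
Proof.
have [d [Sd _]] := sym_diagonalization symS.
have -> : spectrum S = sort >=%R [seq d i | i <- enum 'I_m].
  by apply: spectrumE; rewrite Sd big_map big_enum.
by rewrite (perm_big _ (permEl (perm_sort _ _))) Sd big_map big_enum.
Qed.

Lemma size_spectrum : size (spectrum S) = m.
Proof.
have /(congr1 (fun q : {poly R} => size q)) := char_poly_spectrum.
by rewrite size_char_poly size_prod_XsubC => -[].
Qed.

Lemma spectrum_eigenvector x : x \in spectrum S ->
  exists2 u : 'rV[R]_m, u != 0 & qform S u = x * sqnorm u.
Proof.
move=> xS; have : eigenvalue S x.
  by rewrite eigenvalue_root_char char_poly_spectrum root_prod_XsubC.
move=> /eigenvalueP[u uS u0]; exists u => //.
by rewrite /qform uS -scalemxAl mxE sqnormE.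
Qed.

Lemma spectrum_le_qform c (u : 'rV[R]_m) : all (>= c) (spectrum S) ->
  c * sqnorm u <= qform S u.
Proof.
have [d [Sd Sq]] := sym_diagonalization symS.
move=> /allP cS; have [w [w0 -> ->]] := Sq u.
rewrite big_distrr ler_sum// => i _; rewrite ler_wpM2r//.
apply: cS; rewrite -root_prod_XsubC -char_poly_spectrum Sd.
by rewrite (bigD1 i)//= rootM root_XsubC eqxx.
Qed.

Lemma qform_le_spectrum c (u : 'rV[R]_m) : all (<= c) (spectrum S) ->
  qform S u <= c * sqnorm u.
Proof.
have [d [Sd Sq]] := sym_diagonalization symS.
move=> /allP cS; have [w [w0 -> ->]] := Sq u.
rewrite big_distrr ler_sum// => i _; rewrite ler_wpM2r//.
apply: cS; rewrite -root_prod_XsubC -char_poly_spectrum Sd.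
by rewrite (bigD1 i)//= rootM root_XsubC eqxx.
Qed.

Hypothesis m0 : (0 < m)%N.

Lemma lambda_minE : lambda_min S = nth 0 (spectrum S) m.-1.
Proof. by rewrite /lambda_min -nth_last size_spectrum. Qed.

Lemma lambda_maxE : lambda_max S = nth 0 (spectrum S) 0.
Proof. by rewrite /lambda_max nth0. Qed.

Let nth_anti i j : (i <= j)%N -> (j < m)%N ->
  nth 0 (spectrum S) j <= nth 0 (spectrum S) i.
Proof.
have tr : transitive (>=%R : rel R).
  by move=> y x z /= yx zy; exact: (le_trans zy yx).
have rf : reflexive (>=%R : rel R) by move=> x /=.
move=> ij jm; apply: (sorted_leq_nth tr rf 0 (sorted_ge_spectrum S)) => //.
- by rewrite inE size_spectrum (leq_ltn_trans ij).
- by rewrite inE size_spectrum.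
Qed.

Lemma lambda_min_le_qform (u : 'rV[R]_m) : lambda_min S * sqnorm u <= qform S u.
Proof.
apply: spectrum_le_qform; apply/(all_nthP 0) => i; rewrite size_spectrum => im.
by rewrite lambda_minE /= nth_anti// ?prednK// -ltnS prednK.
Qed.

Lemma qform_le_lambda_max (u : 'rV[R]_m) : qform S u <= lambda_max S * sqnorm u.
Proof.
apply: qform_le_spectrum; apply/(all_nthP 0) => i; rewrite size_spectrum => im.
by rewrite lambda_maxE /= nth_anti.
Qed.

Lemma le_lambda_min c : (forall u : 'rV[R]_m, c * sqnorm u <= qform S u) ->
  c <= lambda_min S.
Proof.
move=> cS; have /spectrum_eigenvector[u u0 Su] : lambda_min S \in spectrum S.
  by rewrite lambda_minE mem_nth// size_spectrum prednK.
have := cS u; rewrite Su ler_pM2r// lt_neqAle sqnorm_ge0 andbT eq_sym.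
by rewrite sqnorm_eq0.
Qed.

Lemma lambda_max_le c : (forall u : 'rV[R]_m, qform S u <= c * sqnorm u) ->
  lambda_max S <= c.
Proof.
move=> cS; have /spectrum_eigenvector[u u0 Su] : lambda_max S \in spectrum S.
  by rewrite lambda_maxE mem_nth// size_spectrum.
have := cS u; rewrite Su ler_pM2r// lt_neqAle sqnorm_ge0 andbT eq_sym.
by rewrite sqnorm_eq0.
Qed.

End Symmetric.

Section SingularValues.
Variables (n p : nat) (A : 'M[R]_(n, p)).

Let symG : (A^T *m A)^T = A^T *m A. Proof. by rewrite trmx_mul trmxK. Qed.
Let symW : (A *m A^T)^T = A *m A^T. Proof. by rewrite trmx_mul trmxK. Qed.

Lemma qform_gram_col (v : 'rV[R]_p) : qform (A^T *m A) v = sqnorm (v *m A^T).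
Proof. by rewrite /qform sqnormE trmx_mul trmxK !mulmxA. Qed.

Lemma qform_gram_row (u : 'rV[R]_n) : qform (A *m A^T) u = sqnorm (u *m A).
Proof. by rewrite /qform sqnormE trmx_mul !mulmxA. Qed.

Let all_ge0_gram_row : all (>= 0) (spectrum (A *m A^T)).
Proof.
apply/allP => x /(spectrum_eigenvector symW)[u u0]; rewrite qform_gram_row => uA.
have : 0 <= x * sqnorm u by rewrite -uA sqnorm_ge0.
by rewrite pmulr_lge0// lt_neqAle sqnorm_ge0 andbT eq_sym sqnorm_eq0.
Qed.

(** The two Gram matrices have the same characteristic polynomial up to a
    power of 'X. Hence the n-th singular value of a wide matrix is governed by the
    n x n Gram matrix, which has no forced zero eigenvalues. *)
Lemma spectrum_gram_wide : (n <= p)%N ->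
  spectrum (A^T *m A) = spectrum (A *m A^T) ++ nseq (p - n) 0.
Proof.
move=> np; have := char_poly_mulmxC A A^T.
rewrite -{1}(subnKC np) exprD -mulrA => /mulfI.
rewrite expf_neq0 ?polyX_eq0// => /(_ isT) E.
rewrite (@spectrumE _ _ (spectrum (A *m A^T) ++ nseq (p - n) 0)); last first.
  rewrite -E big_cat /= big_nseq -char_poly_spectrum// mulrC.
  by rewrite subr0 iter_mulr_1.
apply/sorted_sort.
  by move=> y x z /= yx zy; exact: (le_trans zy yx).
have := all_ge0_gram_row; have := sorted_ge_spectrum (A *m A^T).
case: (spectrum _) => [|x s].
  by move=> _ _; case: (p - n)%N => //= k; elim: k => //= k ->; rewrite lexx.
rewrite /= cat_path => -> /= /andP[x0 s0].
have := mem_last x s; rewrite inE => xs.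
have : 0 <= last x s by case/orP: xs => [/eqP->//|/(allP s0)].
move: (last x s); elim: (p - n)%N => //= k IH y ->; exact: IH.
Qed.

Lemma s_min_ge0 : 0 <= s_min A.
Proof.
rewrite /s_min /singular_values; set k := (minn n p).-1.
have [ks|ks] := ltnP k (size (spectrum (A^T *m A))).
  by rewrite (nth_map 0)// sqrtr_ge0.
by rewrite nth_default ?size_map.
Qed.

Lemma s_max_ge0 : 0 <= s_max A.
Proof.
rewrite /s_max /singular_values.
by case: (spectrum _) => //= x s; exact: sqrtr_ge0.
Qed.

Lemma sqr_s_max : (0 < p)%N -> s_max A ^+ 2 = lambda_max (A^T *m A).
Proof.
move=> p0; rewrite /s_max /singular_values (nth_map 0) ?size_spectrum//.
rewrite -lambda_maxE sqr_sqrtr//.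
have := qform_le_lambda_max symG (delta_mx 0 (Ordinal p0)).
rewrite qform_gram_col => /(le_trans (sqnorm_ge0 _)).
rewrite pmulr_lge0// lt_neqAle sqnorm_ge0 andbT eq_sym sqnorm_eq0.
by apply/eqP => /matrixP/(_ 0 (Ordinal p0))/eqP; rewrite !mxE !eqxx oner_eq0.
Qed.

Lemma sqr_s_min_wide : (0 < n)%N -> (n <= p)%N ->
  s_min A ^+ 2 = lambda_min (A *m A^T).
Proof.
move=> n0 np; have n1 : (n.-1 < n)%N by rewrite prednK.
rewrite /s_min /singular_values (minn_idPl np) (nth_map 0); last first.
  by rewrite size_spectrum// (leq_trans n1).
rewrite spectrum_gram_wide// nth_cat size_spectrum// n1 -lambda_minE// sqr_sqrtr//.
by apply: le_lambda_min => // u; rewrite mul0r qform_gram_row sqnorm_ge0.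
Qed.

Lemma sqr_s_min_tall : (0 < p)%N -> (p <= n)%N ->
  s_min A ^+ 2 = lambda_min (A^T *m A).
Proof.
move=> p0 pn; have p1 : (p.-1 < p)%N by rewrite prednK.
rewrite /s_min /singular_values (minn_idPr pn) (nth_map 0) ?size_spectrum//.
rewrite -lambda_minE// sqr_sqrtr//.
by apply: le_lambda_min => // u; rewrite mul0r qform_gram_col sqnorm_ge0.
Qed.

End SingularValues.

(** A matrix and its transpose have the same operator norm: with [u = v A^T],
    expand [|u A - M v|^2 >= 0] and use [|u|^2 = <u A, v>]. *)
Lemma sqnorm_mul_tr n p (A : 'M[R]_(n, p)) M : 0 <= M ->
  (forall u : 'rV[R]_n, sqnorm (u *m A) <= M * sqnorm u) ->
  forall v : 'rV[R]_p, sqnorm (v *m A^T) <= M * sqnorm v.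
Proof.
move=> M0 AM v; set u := v *m A^T.
have uE : sqnorm u = (u *m A *m v^T) 0 0.
  by rewrite sqnormE {2}/u trmx_mul trmxK mulmxA.
have := AM u; rewrite le_eqVlt in M0; case/orP: M0 => [/eqP <-|M0].
  rewrite !mul0r => uA; have /eqP : sqnorm (u *m A) = 0.
    by apply/eqP; rewrite eq_le uA sqnorm_ge0.
  by rewrite sqnorm_eq0 => /eqP uA0; rewrite uE uA0 mul0mx mxE.
have : 0 <= sqnorm (u *m A - M *: v) by exact: sqnorm_ge0.
have -> : sqnorm (u *m A - M *: v) =
    sqnorm (u *m A) - M * sqnorm u *+ 2 + M ^+ 2 * sqnorm v.
  rewrite uE mxE /sqnorm !big_distrr /= -sumrMnl -sumrB -big_split /=.
  by apply: eq_bigr => j _; rewrite !mxE; ring.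
rewrite expr2 -mulrA => h1 h2.
rewrite -(ler_pM2l M0); lra.
Qed.

Section Variational.
Variables (n p : nat) (A : 'M[R]_(n, p)).
Hypotheses (n0 : (0 < n)%N) (p0 : (0 < p)%N).

Let symG : (A^T *m A)^T = A^T *m A. Proof. by rewrite trmx_mul trmxK. Qed.
Let symW : (A *m A^T)^T = A *m A^T. Proof. by rewrite trmx_mul trmxK. Qed.

Lemma s_max_col (v : 'rV[R]_p) : sqnorm (v *m A^T) <= s_max A ^+ 2 * sqnorm v.
Proof. by rewrite -qform_gram_col sqr_s_max// qform_le_lambda_max. Qed.

Lemma s_max_row (u : 'rV[R]_n) : sqnorm (u *m A) <= s_max A ^+ 2 * sqnorm u.
Proof.
have := @sqnorm_mul_tr _ _ A^T (s_max A ^+ 2) (sqr_ge0 _).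
by rewrite trmxK; apply => v; exact: s_max_col.
Qed.

Lemma s_max_le M : 0 <= M ->
  (forall u : 'rV[R]_n, sqnorm (u *m A) <= M * sqnorm u) -> s_max A ^+ 2 <= M.
Proof.
move=> M0 AM; rewrite sqr_s_max//; apply: lambda_max_le => // v.
by rewrite qform_gram_col sqnorm_mul_tr.
Qed.

Lemma s_min_row (u : 'rV[R]_n) : (n <= p)%N ->
  s_min A ^+ 2 * sqnorm u <= sqnorm (u *m A).
Proof.
by move=> np; rewrite -qform_gram_row sqr_s_min_wide// lambda_min_le_qform.
Qed.

Lemma le_s_min c : (n <= p)%N ->
  (forall u : 'rV[R]_n, c * sqnorm u <= sqnorm (u *m A)) -> c <= s_min A ^+ 2.
Proof.
move=> np cA; rewrite sqr_s_min_wide//; apply: le_lambda_min => // u.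
by rewrite qform_gram_row.
Qed.

Lemma s_min_col (v : 'rV[R]_p) : (p <= n)%N ->
  s_min A ^+ 2 * sqnorm v <= sqnorm (v *m A^T).
Proof.
by move=> np; rewrite -qform_gram_col sqr_s_min_tall// lambda_min_le_qform.
Qed.

End Variational.

End LinAlg.

(** * Integrals against the standard normal law *)

Section IntegralMonotone.
Context d (T : measurableType d) (R : realType).
Variable mu : {measure set T -> \bar R}.

(** Both integrals are suprema over the nonnegative simple functions below the
    integrand, whence monotonicity for arbitrary functions. *)
Lemma ge0_le_integralT (f g : T -> \bar R) : (forall x, 0 <= f x)%E ->
  (forall x, f x <= g x)%E -> (\int[mu]_x f x <= \int[mu]_x g x)%E.
Proof.
move=> f0 fg; have g0 x : (0 <= g x)%E by exact: le_trans (fg x).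
rewrite !ge0_integralTE//; apply: le_ereal_sup => _ [h hf <-].
by exists h => // x; exact: le_trans (fg x).
Qed.

End IntegralMonotone.

Section NormalIntegral.
Context {R : realType}.
Notation leb := (@lebesgue_measure R).
Notation N01 := (@normal_prob R 0 1).

Let pdf_ge0 (x : R) : (0 <= (normal_pdf 0 1 x)%:E)%E.
Proof. by rewrite lee_fin normal_pdf_ge0. Qed.

Let mpdf : measurable_fun setT (EFin \o (@normal_pdf R 0 1)).
Proof. apply/measurable_EFinP. apply: measurable_normal_pdf. Qed.

Import HBNNSimple.

Let integral_normal_nnsfun (f : {nnsfun _ >-> R}) :
  (\int[N01]_x (f x)%:E = \int[leb]_x ((f x)%:E * (normal_pdf 0 1 x)%:E))%E.
Proof.
under [LHS]eq_integral do rewrite fimfunE -fsumEFin//.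
rewrite [LHS]ge0_integral_fsum//; last 2 first.
  - by move=> r; exact/measurable_EFinP/measurableT_comp.
  - by move=> n x _; rewrite EFinM nnfun_muleindic_ge0.
under [RHS]eq_integral.
  move=> x xD; rewrite fimfunE -fsumEFin// ge0_mule_fsuml; last first.
    by move=> r; rewrite EFinM nnfun_muleindic_ge0.
  over.
rewrite [RHS]ge0_integral_fsum//; last 2 first.
  - move=> r; apply: emeasurable_funM => //.
    by apply/measurable_EFinP; do 2 apply/measurableT_comp => //.
  - by move=> n x _; rewrite mule_ge0// EFinM nnfun_muleindic_ge0.
apply: eq_fsbigr => r _.
rewrite integralZl_indic_nnsfun//= integral_indic//= /normal_prob setIT.
have [r0|r0] := leP 0 r; last first.
  have -> : f @^-1` [set r] = set0.
    by apply/seteqP; split => x //= fx; move: r0; rewrite -fx ltNge fun_ge0.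
  rewrite integral_set0 mule0 integral0_eq// => x _.
  by rewrite indic0 mulr0 mul0e.
under [RHS]eq_integral do rewrite EFinM -muleA.
rewrite ge0_integralZl//.
- congr (_ * _)%E; rewrite [LHS]integral_mkcond; apply: eq_integral => x _.
  by rewrite patchE indicE; case: ifPn => _; rewrite ?mul1e ?mul0e.
- by apply: emeasurable_funM => //; exact/measurable_EFinP.
- by move=> x _; rewrite mule_ge0// lee_fin.
Qed.

Lemma ge0_integral_normal (f : measurableTypeR R -> \bar R) :
  measurable_fun setT f -> (forall x, 0 <= f x)%E ->
  (\int[N01]_x f x = \int[leb]_x (f x * (normal_pdf 0 1 x)%:E))%E.
Proof.
move=> mf f0; pose f_ := nnsfun_approx measurableT mf.
transitivity (lim (\int[N01]_x (f_ n x)%:E @[n --> \oo])%E).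
  rewrite -monotone_convergence//=.
  - apply: eq_integral => ? /[!inE] xD; apply/esym/cvg_lim => //=.
    exact: cvg_nnsfun_approx.
  - by move=> n; apply/measurable_EFinP; exact: measurable_funPT.
  - by move=> n ? _; rewrite lee_fin.
  - by move=> ? _ ? ? mn; rewrite lee_fin; exact/lefP/nd_nnsfun_approx.
rewrite [RHS](_ : _ = lim (\int[leb]_x ((f_ n x)%:E * (normal_pdf 0 1 x)%:E)
    @[n --> \oo])%E); last first.
  rewrite -monotone_convergence//=.
  - apply: eq_integral => x _; apply/esym/cvg_lim => //=.
    apply: cvgeZr => //; exact: cvg_nnsfun_approx.
  - by move=> n; apply: emeasurable_funM => //; exact/measurable_EFinP.
  - by move=> n ? _; rewrite mule_ge0// lee_fin.
  - move=> ? _ ? ? mn; rewrite lee_wpmul2r// lee_fin.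
    exact/lefP/nd_nnsfun_approx.
by apply: congr_lim; apply/funext => n /=; exact: integral_normal_nnsfun.
Qed.

(** Complete the square: up to the stated factor, the integrand times the
    standard normal density is the density of variance [(1 + a)^-1] and mean
    [- b / (1 + a)]. *)
Lemma integral_normal_expR_quad (a b : R) : 0 < 1 + a ->
  (\int[N01]_x (expR (- (a * x ^+ 2 / 2 + b * x)))%:E =
   ((Num.sqrt (1 + a))^-1 * expR (b ^+ 2 / (2 * (1 + a))))%:E)%E.
Proof.
move=> a0; set s := (Num.sqrt (1 + a))^-1; set m := - b / (1 + a).
have s0 : 0 < s by rewrite invr_gt0 sqrtr_gt0.
have s2 : s ^+ 2 = (1 + a)^-1 by rewrite exprVn sqr_sqrtr// ltW.
have s_neq0 : s != 0 by rewrite gt_eqF.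
have sq1 (x : R) : expR (- (a * x ^+ 2 / 2 + b * x)) * normal_pdf 0 1 x =
    (s * expR (b ^+ 2 / (2 * (1 + a)))) * normal_pdf m s x.
  rewrite !normal_pdfE// /normal_peak /normal_fun.
  have -> : (Num.sqrt (s ^+ 2 * pi *+ 2))^-1 = s^-1 * (Num.sqrt (1 ^+ 2 * pi *+ 2))^-1 :> R.
    rewrite expr1n mul1r -mulrnAr sqrtrM ?sqr_ge0// sqrtr_sqr gtr0_norm// invfM//.
  set K := (X in s^-1 * X); set E := expR (_ / (s ^+ 2 *+ 2)).
  rewrite (_ : s * _ * (s^-1 * K * E) = K * (expR (b ^+ 2 / (2 * (1 + a))) * E));
    last by field.
  rewrite [LHS]mulrCA -!expRD; congr (_ * expR _).
  rewrite s2 /m; field.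
  by rewrite gt_eqF.
rewrite ge0_integral_normal; last 2 first.
  apply/measurable_EFinP; apply: measurableT_comp => //.
  apply: measurable_funN; apply: measurable_funD; last exact: measurable_funM.
  by apply: measurable_funM => //; apply: measurable_funM => //; exact: measurable_funX.
  by move=> x; rewrite lee_fin expR_ge0.
under eq_integral do rewrite -EFinM sq1 EFinM.
rewrite ge0_integralZl//.
- by rewrite integral_normal_pdf mule1.
- by apply/measurable_EFinP; exact: measurable_normal_pdf.
- by move=> x _; rewrite lee_fin normal_pdf_ge0.
- by rewrite lee_fin mulr_ge0 ?expR_ge0 ?ltW.
Qed.

Lemma expR_le1D2x (s : R) : 0 <= s <= 1 / 2 -> expR s <= 1 + 2 * s.
Proof.
move=> /andP[s0 s1]; have := expR_ge1Dx (- s); rewrite expRN => h.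
have e0 : 0 < expR s by exact: expR_gt0.
have h1 : (1 - s) * expR s <= 1 by rewrite -ler_pdivlMr// div1r.
have : (1 - s) * expR s <= (1 - s) * (1 + 2 * s).
  by apply: (le_trans h1); nra.
by rewrite ler_pM2l//; lra.
Qed.

Let integral_normal_expRM (t : R) :
  (\int[N01]_x (expR (t * x))%:E = (expR (t ^+ 2 / 2))%:E)%E.
Proof.
have := @integral_normal_expR_quad 0 (- t); rewrite addr0 => /(_ ltr01).
rewrite sqrtr1 invr1 mul1r sqrrN mulr1 => <-.
by apply: eq_integral => x _; rewrite !mul0r add0r mulNr opprK.
Qed.

(** The exact value is [a + c]. Since the constant in front of c is irrelevant
    later on, everything is reduced to integrals of exponentials by
    [x^2 + 8 <= 4 (e^x + e^-x)]. The linear term, in contrast, must not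
    contribute at all: it is dominated by [(2 |b| / t) (e^(+- t x) - 1)], whose
    integral is of order t. *)
Lemma integral_normal_quad_le (a b c : R) : 0 <= c ->
  (forall x, 0 <= a + 2 * b * x + c * x ^+ 2) ->
  (\int[N01]_x (a + 2 * b * x + c * x ^+ 2)%:E <= (a + 8 * c)%:E)%E.
Proof.
move=> c0 q0; apply/lee_addgt0Pr => e e0.
pose B := 2 * `|b|; have B0 : 0 <= B by rewrite mulr_ge0.
(* Small enough for the linear term to contribute at most B t <= e. *)
pose t := Num.min 1 (e / (B + 1)).
have t0 : 0 < t by rewrite lt_min ltr01 divr_gt0// ltr_wpDl.
have t1 : t <= 1 by rewrite ge_min lexx.
have Bt : B * t <= e.
  have : t <= e / (B + 1) by rewrite ge_min lexx orbT.
  rewrite ler_pdivlMr ?ltr_wpDl// mulrDr mulr1 mulrC => h.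
  by apply: (le_trans _ h); rewrite lerDl ltW.
pose t' := Num.sg b * t.
have t'2 : t' ^+ 2 / 2 <= t ^+ 2 / 2.
  rewrite ler_pM2r// exprMn ler_piMl ?sqr_ge0//.
  by rewrite sqr_sg; case: (b != 0).
pose k := B / t + 8 * c.
have k0 : 0 <= k by rewrite addr_ge0 ?divr_ge0 ?mulr_ge0// ltW.
pose g x := B / t * expR (t' * x) + (4 * c * expR (1 * x) + 4 * c * expR (- 1 * x)).
have mexp s : measurable_fun setT (fun x : measurableTypeR R => (expR (s * x))).
  by apply: measurableT_comp => //; exact: measurable_funM.
have expR2 x : x ^+ 2 + 8 <= 4 * (expR (1 * x) + expR (- 1 * x)).
  have : (x / 2) ^+ 2 <= (expR (x / 2) - expR (- (x / 2))) ^+ 2.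
    wlog x0 : x / 0 <= x => [H|].
      have [/H//|/ltW x0] := leP 0 x.
      have := H (- x); rewrite oppr_ge0 => /(_ x0).
      by rewrite mulNr sqrrN opprK -[leRHS]sqrrN opprB.
    have e1 : expR (- (x / 2)) <= expR (x / 2) by rewrite ler_expR; lra.
    rewrite ler_sqr ?nnegrE ?subr_ge0// ?divr_ge0//.
    have := expR_ge1Dx (x / 2).
    have : expR (- (x / 2)) <= 1.
      by rewrite -[leRHS]expR0 ler_expR oppr_le0 divr_ge0.
    lra.
  rewrite sqrrB -!expRM_natl -expRD subrr expR0.
  rewrite (_ : 2 * (x / 2) = 1 * x); last by field.
  rewrite (_ : 2 * (- (x / 2)) = - 1 * x); last by field.
  by move=> h; lra.
have qg x : a + 2 * b * x + c * x ^+ 2 + k <= a + g x.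
  have h1 : 2 * b * x + B / t <= B / t * expR (t' * x).
    have -> : 2 * b * x = B / t * (t' * x).
      by rewrite /B /t' [in LHS](numEsg b); field; rewrite gt_eqF.
    rewrite -[X in _ + X]mulr1 -mulrDr ler_wpM2l ?divr_ge0 ?(ltW t0)//.
    by rewrite addrC expR_ge1Dx.
  have : c * (x ^+ 2 + 8) <= c * (4 * (expR (1 * x) + expR (- 1 * x))).
    by rewrite ler_wpM2l ?expR2.
  by rewrite /g /k; lra.
have mq : measurable_fun setT (fun x : measurableTypeR R =>
    (a + 2 * b * x + c * x ^+ 2)%:E).
  apply/measurable_EFinP; apply: measurable_funD.
    by apply: measurable_funD => //; exact: measurable_funM.
  by apply: measurable_funM => //; exact: measurable_funX.
have a0 : 0 <= a by have := q0 0; rewrite expr0n mulr0 mulr0 !addr0.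
have mG C s : measurable_fun setT (fun x : measurableTypeR R => (C * expR (s * x))).
  by apply: measurable_funM => //; exact: mexp.
have mE C s : measurable_fun setT (fun x : measurableTypeR R => (C * expR (s * x))%:E).
  by apply/measurable_EFinP; apply: measurable_funM => //; exact: mexp.
have iE C s : 0 <= C -> (\int[N01]_x (C * expR (s * x))%:E = (C * expR (s ^+ 2 / 2))%:E)%E.
  move=> C0; under eq_integral do rewrite EFinM.
  rewrite ge0_integralZl//; last by apply/measurable_EFinP; exact: mexp.
  by rewrite integral_normal_expRM.
have E0 C s x : 0 <= C -> (0 <= (C * expR (s * x))%:E)%E.
  by move=> C0; rewrite lee_fin mulr_ge0 ?expR_ge0.
have Bt0 : 0 <= B / t by rewrite divr_ge0// ltW.
have c40 : 0 <= 4 * c by rewrite mulr_ge0.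
have G0 C s x : 0 <= C -> 0 <= C * expR (s * x).
  by move=> C0; rewrite mulr_ge0 ?expR_ge0.
have iD (f h : measurableTypeR R -> R) : (forall x, 0 <= f x) -> (forall x, 0 <= h x) ->
    measurable_fun setT f -> measurable_fun setT h ->
    (\int[N01]_x (f x + h x)%:E = \int[N01]_x (f x)%:E + \int[N01]_x (h x)%:E)%E.
  move=> f0 h0 mf mh; under eq_integral do rewrite EFinD.
  apply: ge0_integralD => //.
  - by move=> x _; rewrite lee_fin.
  - exact/measurable_EFinP.
  - by move=> x _; rewrite lee_fin.
  - exact/measurable_EFinP.
have ig : (\int[N01]_x (a + g x)%:E =
    (a + (B / t * expR (t' ^+ 2 / 2) + (4 * c * expR (1 / 2) + 4 * c * expR (1 / 2))))%:E)%E.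
  have mG2 : measurable_fun setT (fun x : measurableTypeR R =>
      4 * c * expR (1 * x) + 4 * c * expR (- 1 * x)).
    by apply: measurable_funD; exact: mG.
  rewrite (iD (cst a) g) //=; last 2 first.
  - by move=> x; rewrite /g !addr_ge0 ?G0.
  - by apply: measurable_funD; [exact: mG|exact: mG2].
  rewrite integral_cst//= probability_setT mule1 EFinD; congr (_ + _)%E.
  rewrite /g (iD (fun x => B / t * expR (t' * x))
    (fun x => 4 * c * expR (1 * x) + 4 * c * expR (- 1 * x))) //=; last 2 first.
  - by move=> x; rewrite G0.
  - by move=> x; rewrite addr_ge0 ?G0.
  rewrite iE// EFinD; congr (_ + _)%E.
  rewrite (iD (fun x => 4 * c * expR (1 * x)) (fun x => 4 * c * expR (- 1 * x)))//=.
  - by rewrite !iE// sqrrN expr1n EFinD.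
  - by move=> x; rewrite G0.
  - by move=> x; rewrite G0.
rewrite -(@leeD2rE _ k%:E)//.
have -> : (\int[N01]_x (a + 2 * b * x + c * x ^+ 2)%:E + k%:E =
    \int[N01]_x (a + 2 * b * x + c * x ^+ 2 + k)%:E)%E.
  rewrite (iD _ (cst k)) //=; last exact/measurable_EFinP.
  by rewrite integral_cst//= probability_setT mule1.
apply: le_trans.
  refine (@ge0_le_integralT _ _ R (@normal_prob R 0 1)
    (fun x => (a + 2 * b * x + c * x ^+ 2 + k)%:E) (fun x => (a + g x)%:E) _ _) => x;
    rewrite lee_fin; last exact: qg.
  by rewrite addr_ge0.
rewrite ig.
rewrite -!EFinD lee_fin.
have e1 : expR (1 / 2) <= 2 :> R by apply: (le_trans (expR_le1D2x _)); lra.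
have e2 : expR (t' ^+ 2 / 2) <= 1 + t ^+ 2.
  apply: (@le_trans _ _ (expR (t ^+ 2 / 2))); first by rewrite ler_expR.
  have t21 : t ^+ 2 <= 1 by rewrite expr_le1// ltW.
  apply: (le_trans (expR_le1D2x _)); last by lra.
  by rewrite divr_ge0 ?sqr_ge0//=; lra.
have : B / t * expR (t' ^+ 2 / 2) <= B / t * (1 + t ^+ 2) by rewrite ler_wpM2l.
have -> : B / t * (1 + t ^+ 2) = B / t + B * t by field; rewrite gt_eqF.
have : 4 * c * expR (1 / 2) <= 4 * c * 2 by rewrite ler_wpM2l.
by rewrite /k; lra.
Qed.

End NormalIntegral.

(** * Families of independent normal coordinates *)

Section Coordinates.
Context {R : realType} {I : finType}.

(** Measurability of a function of the coordinates, expressed through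
    measurable families so that no sigma-algebra has to be put on [I -> R]. *)
Definition borel_functional (Phi : (I -> R) -> R) : Prop :=
  forall d (U : measurableType d) (Y : I -> U -> R),
    (forall i, measurable_fun setT (Y i)) ->
    measurable_fun setT (fun u => Phi (Y ^~ u)).

Definition upd (z : I -> R) (k : I) (x : R) : I -> R :=
  fun i => if i == k then x else z i.

Definition tuple_of_coords (z : I -> R) : #|I|.-tuple R := [tuple z (enum_val j) | j < #|I|].

Definition coords_of_tuple (t : #|I|.-tuple R) : I -> R := fun i => tnth t (enum_rank i).

Lemma tuple_of_coordsK : cancel tuple_of_coords coords_of_tuple.
Proof. by move=> z; apply/funext => i; rewrite /coords_of_tuple tnth_mktuple enum_rankK. Qed.

Lemma measurable_tuple_of_coords d (U : measurableType d) (Y : I -> U -> R) :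
  (forall i, measurable_fun setT (Y i)) ->
  measurable_fun setT (fun u => tuple_of_coords (Y ^~ u)).
Proof.
move=> mY; apply/measurable_fun_tnthP => j.
rewrite (_ : _ \o _ = Y (enum_val j))//.
by apply/funext => u; rewrite /= tnth_mktuple.
Qed.

(** Boxes generate the product sigma-algebra and are stable under
    intersection, so two finite measures that agree on them are equal. *)
Definition box (E : I -> set R) : set (#|I|.-tuple R) :=
  [set t | forall i, E i (coords_of_tuple t i)].

Definition boxes : set (set (#|I|.-tuple R)) :=
  [set B | exists2 E : I -> set R, (forall i, measurable (E i)) & B = box E].

Lemma measurable_boxes : measurable = <<s boxes >>.
Proof.
apply/seteqP; split; last first.
  apply: smallest_sub; first exact: sigma_algebra_measurable.
  move=> _ [E mE ->].
  rewrite (_ : box E = \bigcap_(i in [set: I]) ((fun t => coords_of_tuple t i) @^-1` E i)).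
    apply: fin_bigcap_measurable => // i _.
    rewrite -[_ @^-1` _]setTI; apply: (@measurable_tnth _ _ _ (enum_rank i)) => //.
  by apply/seteqP; split => t /= tE i; [move=> _|]; apply: tE.
apply: smallest_sub; first exact: smallest_sigma_algebra.
move=> A; rewrite -bigcup_seq => -[j /= _ [B mB <-]]; apply: sub_sigma_algebra.
exists (fun i => if i == enum_val j then B else setT) => [i|]; first by case: ifP.
apply/seteqP; split => t /=.
  by move=> [_ tB] i; case: eqP => // ->; rewrite /coords_of_tuple enum_valK.
move=> tB; split => //; have := tB (enum_val j).
by rewrite eqxx /coords_of_tuple enum_valK.
Qed.

Lemma setI_closed_boxes : setI_closed boxes.
Proof.
move=> _ _ [E mE ->] [F mF ->]; exists (fun i => E i `&` F i).
  by move=> i; exact: measurableI.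
apply/seteqP; split => t /= => [[tE tF] i|tEF]; first by split.
by split => i; have [] := tEF i.
Qed.

End Coordinates.

Section CoordinateFubini.
Context d (T : measurableType d) (R : realType) (P : probability T R).
Context {I : finType}.
Notation N01 := (@normal_prob R 0 1).

Definition iid_normal (Z : I -> {RV P >-> R}) : Prop :=
  (forall i (B : set R), measurable B -> distribution P (Z i) B = normal_prob 0 1 B) /\
  mutually_independent P (fun i => preimage_set_system setT (Z i) measurable).

Variable Z : I -> {RV P >-> R}.
Hypothesis iidZ : iid_normal Z.

Lemma iid_normal_box (E : I -> set R) : (forall i, measurable (E i)) ->
  P [set w | forall i, E i (Z i w)] = (\prod_i N01 (E i))%E.
Proof.
move=> mE; have [Zn Zi] := iidZ.
have := Zi [set: I]%SET (fun i => Z i @^-1` E i).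
rewrite (_ : \bigcap_(i in _) _ = [set w | forall i, E i (Z i w)]); last first.
  apply/seteqP; split => w /= wE i; first by apply: wE; rewrite /= inE.
  by move=> _; exact: wE.
move=> -> => [|i _]; last by exists (E i) => //; rewrite setTI.
by apply: eq_big => i; rewrite ?inE// => _; exact: Zn.
Qed.

(** Resampling the coordinate k leaves the joint law unchanged: the laws of
    [Z] and of [upd Z k x], with x drawn independently of [Z], agree on boxes by
    independence, hence everywhere; then Tonelli integrates x out first. *)
Lemma coordinate_fubini (Phi : (I -> R) -> R) (k : I) :
  borel_functional Phi -> (forall z, 0 <= Phi z) ->
  (\int[P]_w (Phi (Z ^~ w))%:E =
   \int[P]_w \int[N01]_x (Phi (upd (Z ^~ w) k x))%:E)%E.
Proof.
move=> mPhi Phi0.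
pose f1 w := tuple_of_coords (Z ^~ w).
pose f2 (wx : T * measurableTypeR R) := tuple_of_coords (upd (Z ^~ wx.1) k wx.2).
have mf1 : measurable_fun setT f1 by apply: measurable_tuple_of_coords => i.
have mupd i : measurable_fun setT (fun wx : T * measurableTypeR R => upd (Z ^~ wx.1) k wx.2 i).
  by rewrite /upd; case: eqP => _ //; apply: measurableT_comp.
have mf2 : measurable_fun setT f2 by exact: measurable_tuple_of_coords.
pose X1 : {mfun T >-> #|I|.-tuple R} := HB.pack f1 (isMeasurableFun.Build _ _ _ _ _ mf1).
pose X2 : {mfun (T * measurableTypeR R)%type >-> #|I|.-tuple R} :=
  HB.pack f2 (isMeasurableFun.Build _ _ _ _ _ mf2).
pose Q := (P \x N01)%E.
pose g (t : #|I|.-tuple R) := (Phi (coords_of_tuple t))%:E.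
have mg : measurable_fun setT g.
  apply/measurable_EFinP; apply: (mPhi _ _ (fun i t => coords_of_tuple t i)) => i.
  exact: measurable_tnth.
have g0 t : (0 <= g t)%E by rewrite lee_fin.
transitivity (\int[distribution P X1]_t g t)%E.
  rewrite ge0_integral_distribution//; apply: eq_integral => w _.
  by rewrite /g /= /f1 tuple_of_coordsK.
transitivity (\int[distribution Q X2]_t g t)%E; last first.
  rewrite ge0_integral_distribution//.
  rewrite (fubini_tonelli1 (g \o X2)) //.
  - apply: eq_integral => w _; apply: eq_integral => x _.
    by rewrite /g /= /f2 tuple_of_coordsK.
  - by apply: measurableT_comp.
  - by move=> x; exact: g0.
apply: eq_measure_integral => A mA _.
apply: (measure_unique boxes (fun=> setT)) => //.
- exact: measurable_boxes.
- exact: setI_closed_boxes.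
- move=> _; exists (fun=> setT) => //.
  by apply/seteqP; split.
- by rewrite bigcup_const.
- move=> _ [E mE ->].
  have X1E : X1 @^-1` box E = [set w | forall i, E i (Z i w)].
    by apply/seteqP; split => w /= wE i; have := wE i; rewrite /f1 tuple_of_coordsK.
  (* After resampling, the old value of the coordinate k is unconstrained. *)
  pose E' i := if i == k then setT else E i.
  have mE' i : measurable (E' i) by rewrite /E'; case: ifP.
  have X2E : X2 @^-1` box E = [set w | forall i, E' i (Z i w)] `*` E k.
    apply/seteqP; split => -[w x]; rewrite /= /box /= /f2 tuple_of_coordsK /=.
      move=> wE; split => [i|]; last by have := wE k; rewrite /upd eqxx.
      by have := wE i; rewrite /E' /upd; case: eqP.
    by move=> [wE xE] i; have := wE i; rewrite /E' /upd; case: eqP => // ->.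
  have mS : measurable [set w | forall i, E' i (Z i w)].
    rewrite (_ : [set w | _] = \bigcap_(i in [set: I]) (Z i @^-1` E' i)).
      apply: fin_bigcap_measurable => // i _.
      by rewrite -[_ @^-1` _]setTI; exact: measurable_funPT.
    by apply/seteqP; split => w /= wE i; [move=> _|]; apply: wE.
  transitivity (P [set w | forall i, E i (Z i w)]); first by rewrite -X1E.
  transitivity (Q (X2 @^-1` box E)); last by [].
  rewrite X2E /Q product_measure1E//.
  transitivity (P [set w | forall i, E' i (Z i w)] * N01 (E k))%E; last by [].
  rewrite (iid_normal_box mE) (iid_normal_box mE') (bigD1 k)//= [in RHS](bigD1 k)//=.
  rewrite {1}/E' eqxx probability_setT mul1e muleC; congr (_ * _)%E.
  by apply: eq_bigr => i ik; rewrite /E' (negbTE ik).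
  exact: mE.
- by move=> _; rewrite (le_lt_trans (probability_le1 (distribution P X1) _))// ltry.
Qed.

End CoordinateFubini.

Section RowsToCoordinates.
Context d (T : measurableType d) (R : realType) (P : probability T R).

(** Since [Sigma] is invertible, the normal vector [Z_i = X_i A_i^-1] that
    generates the i-th row is a measurable function of that row. Independence of
    the rows therefore passes to the vectors [Z_i], and combines with the
    independence of the coordinates within each of them. *)
Lemma iid_normal_rows_coords n p (X : T -> 'M[R]_(n, p)) (Sigma : 'M[R]_p) :
  Sigma \in unitmx -> iid_normal_rows P X Sigma ->
  exists (A : 'I_n -> 'M[R]_p) (Z : 'I_n * 'I_p -> {RV P >-> R}),
    [/\ iid_normal Z, (forall i, (A i)^T *m A i = Sigma) &
        forall w i, row i (X w) = (\row_l Z (i, l) w) *m A i].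
Proof.
move=> Su [Xn Xi].
have {Xn} /choice[AZ AZP] : forall i, exists AZ : 'M[R]_p * ('I_p -> {RV P >-> R}),
    [/\ AZ.1^T *m AZ.1 = Sigma, standard_normal_vector AZ.2 &
        forall w, row i (X w) = (\row_j AZ.2 j w) *m AZ.1].
  by move=> i; have [A [Z [h1 h2 h3]]] := Xn i; exists (A, Z).
pose A i := (AZ i).1; pose Z (il : 'I_n * 'I_p) := (AZ il.1).2 il.2.
exists A, Z; split; last 2 first.
- by move=> i; have [] := AZP i.
- by move=> w i; have [_ _ ->] := AZP i.
have Aunit i : A i \in unitmx.
  have [AS _ _] := AZP i; move: Su; rewrite -AS -/(A i) !unitmxE det_mulmx.
  by rewrite unitrM => /andP[].
split; first by move=> [i l] B mB; have [_ [-> //]] := AZP i.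
move=> J E JE.
pose E' il := if il \in J then E il else setT.
have E'P il : preimage_set_system setT (Z il) measurable (E' il).
  rewrite /E'; case: ifPn => [/JE//|_]; exists setT => //.
  by rewrite preimage_setT setTI.
pose F i := \bigcap_(l in [set: 'I_p]) E' (i, l).
have PF i : P (F i) = (\prod_l P (E' (i, l)))%E.
  have [_ [_ Zi] _] := AZP i.
  have := Zi [set: 'I_p]%SET (fun l => E' (i, l)) (fun l _ => E'P (i, l)).
  have -> : [set` [set: 'I_p]%SET] = [set: 'I_p] by apply/seteqP; split => l //= _; rewrite inE.
  by move=> ->; apply: eq_bigl => l; rewrite inE.
have GF i : g_sigma_preimage (fun (j : 'I_p) (w : T) => X w i j) (F i).
  set G := \big[setU/set0]_(j < p) preimage_set_system setT (fun w : T => X w i j) measurable.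
  have mX j : measurable_fun setT ((fun w => X w i j) : g_sigma_algebraType G -> R).
    move=> _ B mB; apply: sub_sigma_algebra; rewrite /G -bigcup_seq.
    by exists j; [rewrite /= mem_index_enum|exists B].
  have mZ l : measurable_fun setT ((fun w => Z (i, l) w) : g_sigma_algebraType G -> R).
    have [_ _ XE] := AZP i.
    rewrite (_ : (fun w => _) = fun w => \sum_j X w i j * invmx (A i) j l).
      by apply: measurable_sum => j; exact: measurable_funM.
    apply/funext => w; have := XE w => /(congr1 (mulmxr (invmx (A i)))) /=.
    rewrite -/(A i) mulmxK ?Aunit// => /matrixP/(_ 0 l); rewrite !mxE => <-.
    by apply: eq_bigr => j _; rewrite mxE.
  have : @measurable _ (g_sigma_algebraType G) (F i); last by [].
  apply: fin_bigcap_measurable => // l _.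
  by have [B mB <-] := E'P (i, l); exact: mZ.
have := Xi [set: 'I_n]%SET F (fun i _ => GF i).
have -> : \bigcap_(i in [set` [set: 'I_n]%SET]) F i = \bigcap_(i in [set` J]) E i.
  apply/seteqP; split => w /= h.
    move=> [i l] /= ilJ; have := h i; rewrite /= inE => /(_ isT l I).
    by rewrite /E' ilJ.
  move=> i _ l _; rewrite /E'; case: ifPn => // ilJ.
  exact: (h (i, l)).
move=> ->; rewrite [RHS]big_mkcond /=.
transitivity (\prod_i \prod_l P (E' (i, l)))%E.
  by apply: eq_big => i; rewrite ?inE.
rewrite pair_bigA /=; apply: eq_bigr => -[i l] _; rewrite /E' /=.
by case: ifP => //; rewrite probability_setT.
Qed.

End RowsToCoordinates.

(** * Determinants and rank-one updates *)

Section Determinants.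
Context {R : realType}.

Lemma det_spectrum m (S : 'M[R]_m) : S^T = S -> \det S = \prod_(x <- spectrum S) x.
Proof.
move=> symS; have := char_poly_det S; rewrite char_poly_spectrum//.
rewrite -horner_coef0 horner_prod.
have -> : \prod_(x <- spectrum S) ('X - x%:P).[0] = (-1) ^+ m * \prod_(x <- spectrum S) x.
  rewrite -{2}(size_spectrum symS); elim: (spectrum S) => [|x s IH].
    by rewrite !big_nil expr0 mulr1.
  by rewrite !big_cons IH /= hornerXsubC sub0r exprS; ring.
by move=> /mulfI -> //; rewrite signr_eq0.
Qed.

(** All the eigenvalues are at least c, and the determinant is their product. *)
Lemma det_ge m (S : 'M[R]_m) c : S^T = S -> 0 <= c ->
  (forall u, c * sqnorm u <= qform S u) -> c ^+ m <= \det S.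
Proof.
move=> symS c0 cS; rewrite det_spectrum//.
have : all (>= c) (spectrum S).
  apply/allP => x /(spectrum_eigenvector symS)[u u0 uS].
  have := cS u; rewrite uS ler_pM2r// lt_neqAle sqnorm_ge0 andbT eq_sym.
  by rewrite sqnorm_eq0.
suff : all (>= c) (spectrum S) -> c ^+ size (spectrum S) <= \prod_(x <- spectrum S) x.
  by rewrite size_spectrum.
elim: (spectrum S) => [|x s IH] /=; first by rewrite big_nil expr0.
move=> /andP[cx cs]; rewrite big_cons exprS ler_pM ?exprn_ge0//.
exact: IH.
Qed.

Lemma det_gt0 m (S : 'M[R]_m) c : S^T = S -> 0 < c ->
  (forall u, c * sqnorm u <= qform S u) -> 0 < \det S.
Proof.
by move=> symS c0 /(det_ge symS (ltW c0)); apply: lt_le_trans; rewrite exprn_gt0.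
Qed.

Lemma qformD m (S M : 'M[R]_m) u : qform (S + M) u = qform S u + qform M u.
Proof. by rewrite /qform mulmxDr mulmxDl mxE. Qed.

Lemma qformZ m a (M : 'M[R]_m) u : qform (a *: M) u = a * qform M u.
Proof. by rewrite /qform -scalemxAr -scalemxAl mxE. Qed.

Lemma qform_sum m J (r : seq J) (F : J -> 'M[R]_m) u :
  qform (\sum_(j <- r) F j) u = \sum_(j <- r) qform (F j) u.
Proof. by rewrite /qform mulmx_sumr mulmx_suml summxE. Qed.

Lemma qform_tr_mul m n (b : 'M[R]_(n, m)) u : qform (b^T *m b) u = sqnorm (u *m b^T).
Proof. by rewrite /qform sqnormE trmx_mul trmxK !mulmxA. Qed.

Lemma qform_scalar m a (u : 'rV[R]_m) : qform a%:M u = a * sqnorm u.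
Proof. by rewrite /qform mul_mx_scalar -scalemxAl mxE sqnormE. Qed.

Section RankOne.
Variables (m : nat) (H : 'M[R]_m) (b : 'rV[R]_m) (e : R).
Hypotheses (symH : H^T = H) (Hu : H \in unitmx).
Let beta := qform (invmx H) b.
Let H' := H + e *: (b^T *m b).

Let symHi : (invmx H)^T = invmx H. Proof. by rewrite trmx_inv symH. Qed.

(** The matrix determinant lemma: the second factor is the 1 x 1 determinant
    to which Sylvester's identity reduces [H^-1 H']. *)
Lemma det_rank1_update : \det H' = \det H * (1 + e * beta).
Proof.
have -> : H' = H *m (1%:M - (- e *: (invmx H *m b^T)) *m b).
  rewrite mulmxBr mulmx1 -scalemxAl scaleNr mulmxN opprK -scalemxAr.
  by rewrite !mulmxA mulmxV// mul1mx.
rewrite det_mulmx; congr (_ * _).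
have := det_scalar_sub_mulmxC (- e *: (invmx H *m b^T)) b 1.
rewrite !expr1n !mul1r => ->.
by rewrite det_mx11 -scalemxAr mulmxA scaleNr opprK mxE [X in X + _]mxE eqxx [X in _ + X]mxE.
Qed.

(** The Sherman-Morrison formula, evaluated as a quadratic form. *)
Lemma invmx_rank1_update (y : 'rV[R]_m) : 1 + e * beta != 0 ->
  qform (invmx H') y =
  qform (invmx H) y - e / (1 + e * beta) * (y *m invmx H *m b^T) 0 0 ^+ 2.
Proof.
move=> eb; set c := (y *m invmx H *m b^T) 0 0.
have cE : y *m invmx H *m b^T = c%:M by rewrite [LHS]mx11_scalar.
have cE' : b *m invmx H *m y^T = c%:M.
  by have := congr1 trmx cE; rewrite !trmx_mul trmxK symHi tr_scalar_mx mulmxA.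
have bE : b *m invmx H *m b^T = beta%:M by rewrite [LHS]mx11_scalar.
have H'u : H' \in unitmx.
  rewrite unitmxE det_rank1_update unitrM -unitmxE Hu /=.
  by rewrite unitfE.
pose k := e / (1 + e * beta).
have : (y *m invmx H - (k * c) *: (b *m invmx H)) *m H' = y.
  rewrite mulmxBl -scalemxAl /H' !mulmxDr -!scalemxAr !mulmxA.
  rewrite !mulmxKV// cE bE !mul_scalar_mx !scalerA.
  rewrite -[in X in _ - X](scale1r b) scalerA -scalerDl mulr1 scalerA.
  rewrite -addrA -scalerBl (_ : e * c - _ = 0) ?scale0r ?addr0//.
  by rewrite /k; field.
move=> /(congr1 (mulmxr (invmx H'))) /=; rewrite mulmxK// => yE.
rewrite /qform -yE mulmxBl -scalemxAl cE' !mxE eqxx !mulr1n -/k.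
by rewrite expr2 mulrA.
Qed.

End RankOne.
End Determinants.

(** * Laplace transform of a Gaussian quadratic form *)

Section BorelForms.
Context d (U : measurableType d) (R : realType).

Lemma measurable_sqnorm m (V : U -> 'rV[R]_m) :
  (forall j, measurable_fun setT (fun u => V u 0 j)) ->
  measurable_fun setT (fun u => sqnorm (V u)).
Proof.
by move=> mV; apply: measurable_sum => j; apply: measurable_funX; exact: mV.
Qed.

Lemma measurable_mulmx m n p (V : U -> 'M[R]_(m, n)) (W : U -> 'M[R]_(n, p)) :
  (forall i j, measurable_fun setT (fun u => V u i j)) ->
  (forall i j, measurable_fun setT (fun u => W u i j)) ->
  forall i j, measurable_fun setT (fun u => (V u *m W u) i j).
Proof.
move=> mV mW i j; rewrite (_ : (fun u => _) = (fun u => \sum_k V u i k * W u k j)).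
  by apply: measurable_sum => k; apply: measurable_funM; [exact: mV|exact: mW].
by apply/funext => u; rewrite mxE.
Qed.

Lemma measurable_qform m (S : 'M[R]_m) (V : U -> 'rV[R]_m) :
  (forall j, measurable_fun setT (fun u => V u 0 j)) ->
  measurable_fun setT (fun u => qform S (V u)).
Proof.
move=> mV; apply: (@measurable_mulmx _ _ _ (fun u => V u *m S) (fun u => (V u)^T)).
  apply: (@measurable_mulmx _ _ _ V (cst S)) => [i j|i j]; last exact: measurable_cst.
  by rewrite ord1.
move=> i j; rewrite ord1 (_ : (fun u => _) = (fun u => V u 0 i)) //.
by apply/funext => u; rewrite mxE.
Qed.

End BorelForms.

Section GaussianLaplace.
Context d (T : measurableType d) (R : realType) (P : probability T R).
Context {I : finType} (Z : I -> {RV P >-> R}).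
Hypothesis iidZ : iid_normal Z.
Notation N01 := (@normal_prob R 0 1).

Variables (m : nat) (b : I -> 'rV[R]_m).

Definition lincomb (s : seq I) (z : I -> R) : 'rV[R]_m := \sum_(i <- s) z i *: b i.

Lemma measurable_lincomb d' (U : measurableType d') (s : seq I) (Y : I -> U -> R) :
  (forall i, measurable_fun setT (Y i)) ->
  forall j, measurable_fun setT (fun u => lincomb s (Y ^~ u) 0 j).
Proof.
move=> mY j; rewrite (_ : (fun u => _) = (fun u => \sum_(i <- s) Y i u * b i 0 j)).
  by apply: measurable_sum => i; apply: measurable_funM => //; exact: mY.
by apply/funext => u; rewrite summxE; apply: eq_bigr => i _; rewrite mxE.
Qed.

Lemma lincomb_upd_notin s z k x : k \notin s -> lincomb s (upd z k x) = lincomb s z.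
Proof.
move=> ks; rewrite /lincomb big_seq [RHS]big_seq; apply: eq_bigr => i is_.
by rewrite /upd; case: eqP => // ik; move: ks; rewrite -ik is_.
Qed.

Lemma lincomb_cons_upd s z k x : k \notin s ->
  lincomb (k :: s) (upd z k x) = lincomb s z + x *: b k.
Proof.
move=> ks; rewrite {1}/lincomb big_cons -/(lincomb _ _) lincomb_upd_notin//.
by rewrite /upd eqxx addrC.
Qed.

(** The covariance matrix of [lincomb s Z]. *)
Definition scatter (s : seq I) : 'M[R]_m := \sum_(i <- s) (b i)^T *m b i.

Lemma tr_scatter s : (scatter s)^T = scatter s.
Proof.
by rewrite /scatter linear_sum; apply: eq_bigr => i _ /=; rewrite trmx_mul trmxK.
Qed.

Lemma qform_scatter_ge0 s u : 0 <= qform (scatter s) u.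
Proof. by rewrite qform_sum sumr_ge0// => i _; rewrite qform_tr_mul sqnorm_ge0. Qed.

Variable e : R.
Hypothesis e1 : (e == 1) || (e == -1).

Let e2 : e ^+ 2 = 1.
Proof. by case/orP: e1 => /eqP ->; rewrite ?sqrrN expr1n. Qed.

(** One normal coordinate changes H into [H + e v^T v]: the Gaussian integral
    in x produces the factor [(1 + e beta)^(-1/2)], which is a ratio of
    determinants by [det_rank1_update], and an exponent that
    [invmx_rank1_update] identifies. Both signs e = 1 (lower tails) and e = -1
    (upper tails) are covered. *)
Lemma integral_normal_expR_qform (H : 'M[R]_m) (y v : 'rV[R]_m) :
  H^T = H -> 0 < \det H -> 0 < \det (H + e *: (v^T *m v)) ->
  (\int[N01]_x (expR (- e / 2 * qform (invmx H) (y + x *: v)))%:E =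
   (Num.sqrt (\det H / \det (H + e *: (v^T *m v))) *
    expR (- e / 2 * qform (invmx (H + e *: (v^T *m v))) y))%:E)%E.
Proof.
move=> symH dH dH'.
have Hu : H \in unitmx by rewrite unitmxE unitfE gt_eqF.
have symHi : (invmx H)^T = invmx H by rewrite trmx_inv symH.
set beta := qform (invmx H) v; set c := (y *m invmx H *m v^T) 0 0.
have dE := det_rank1_update v e Hu; rewrite -/beta in dE.
have b0 : 0 < 1 + e * beta by rewrite -(pmulr_rgt0 _ dH) -dE.
have qE x : qform (invmx H) (y + x *: v) =
    qform (invmx H) y + 2 * x * c + x ^+ 2 * beta.
  have cE' : (v *m invmx H *m y^T) 0 0 = c.
    rewrite /c; have <- : (v *m invmx H *m y^T)^T = y *m invmx H *m v^T.
      by rewrite !trmx_mul trmxK symHi mulmxA.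
    by rewrite [RHS]mxE.
  have DE (A B : 'M[R]_1) : (A + B) 0 0 = A 0 0 + B 0 0 by rewrite mxE.
  have ZE a (A : 'M[R]_1) : (a *: A) 0 0 = a * A 0 0 by rewrite mxE.
  rewrite {1}/qform linearD linearZ /= !mulmxDl !mulmxDr -!scalemxAl -!scalemxAr.
  rewrite !(DE, ZE) cE' -/c /beta /qform; ring.
rewrite invmx_rank1_update ?gt_eqF// -/beta -/c dE.
have -> : \det H / (\det H * (1 + e * beta)) = (1 + e * beta)^-1.
  by field; rewrite !gt_eqF.
rewrite sqrtrV ?ltW//.
have -> : expR (- e / 2 * (qform (invmx H) y - e / (1 + e * beta) * c ^+ 2)) =
  expR ((e * c) ^+ 2 / (2 * (1 + e * beta))) * expR (- e / 2 * qform (invmx H) y).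
  rewrite -expRD; congr expR; rewrite exprMn -{2}[e in RHS]mulr1.
  field; by rewrite gt_eqF.
rewrite mulrA EFinM -integral_normal_expR_quad//.
rewrite muleC -ge0_integralZl//=.
- apply: eq_integral => x _; rewrite -EFinM -expRD qE; congr (expR _)%:E; by field.
apply/measurable_EFinP; apply: measurableT_comp => //.
apply: measurable_funN; apply: measurable_funD; last exact: measurable_funM.
by apply: measurable_funM => //; apply: measurable_funM => //; exact: measurable_funX.
Qed.

(** Induction over the coordinates, integrating one at a time; the determinant
    ratios telescope. The two lower bounds keep every intermediate matrix positive
    definite: when e = 1 the matrices increase from H, and when e = -1 they
    decrease to [H - scatter s]. *)
Lemma integral_expR_qform_lincomb (s : seq I) (H : 'M[R]_m) (c : R) :
  uniq s -> H^T = H -> 0 < c -> (forall u, c * sqnorm u <= qform H u) ->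
  (forall u, c * sqnorm u <= qform (H + e *: scatter s) u) ->
  (\int[P]_w (expR (- e / 2 * qform (invmx H) (lincomb s (Z ^~ w))))%:E =
   (Num.sqrt (\det H / \det (H + e *: scatter s)))%:E)%E.
Proof.
elim: s H => [|k s IH] H /=.
  move=> _ symH c0 cH _; rewrite /scatter big_nil scaler0 addr0 divff ?sqrtr1.
    rewrite -(probability_setT P) -[RHS]mul1e -(integral_cst P)//.
    apply: eq_integral => w _.
    by rewrite /lincomb big_nil /qform mul0mx mul0mx mxE mulr0 expR0.
  by rewrite gt_eqF// (det_gt0 symH c0 cH).
move=> /andP[ks us] symH c0 cH cHs.
set H' := H + e *: ((b k)^T *m b k).
have HsE : H + e *: scatter (k :: s) = H' + e *: scatter s.
  by rewrite /scatter big_cons scalerDr addrA.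
have symH' : H'^T = H' by rewrite /H' linearD linearZ /= symH trmx_mul trmxK.
have cH' u : c * sqnorm u <= qform H' u.
  case/orP: e1 => /eqP eE.
    rewrite /H' qformD qformZ eE mul1r (le_trans (cH u))// lerDl.
    by rewrite qform_tr_mul sqnorm_ge0.
  have := cHs u; rewrite HsE qformD qformZ eE mulN1r => h.
  by apply: (le_trans h); rewrite gerDl oppr_le0 qform_scatter_ge0.
have dH := det_gt0 symH c0 cH; have dH' := det_gt0 symH' c0 cH'.
have dHs : 0 < \det (H' + e *: scatter s).
  apply: (@det_gt0 _ _ _ c) => //; last by rewrite -HsE.
  by rewrite linearD linearZ /= tr_scatter symH'.
have mexp r (M : 'M[R]_m) : borel_functional (fun z => expR (- e / 2 * qform M (lincomb r z))).
  move=> d' U Y mY; apply: measurableT_comp => //; apply: measurable_funM => //.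
  by apply: measurable_qform => j; exact: measurable_lincomb.
rewrite (coordinate_fubini iidZ k (mexp _ _)); last by move=> z; exact: expR_ge0.
under eq_integral => w _.
  under eq_integral do rewrite lincomb_cons_upd//.
  rewrite integral_normal_expR_qform// EFinM.
  over.
rewrite ge0_integralZl//=; last first.
  by apply/measurable_EFinP; apply: (mexp _ _ _ _ (fun i w => Z i w)) => i.
rewrite IH// -?HsE// -EFinM -sqrtrM; last by rewrite divr_ge0 ?ltW.
by congr (Num.sqrt _)%:E; field; rewrite HsE !gt_eqF.
Qed.

End GaussianLaplace.

(** * Tails of the norm of a combination of rows *)

Section RowMixture.
Context {R : realType} {n p : nat}.
Variable A : 'I_n -> 'M[R]_p.

Definition matrix_of_coords (z : 'I_n * 'I_p -> R) : 'M[R]_(n, p) :=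
  \matrix_i ((\row_l z (i, l)) *m A i).

Lemma row_matrix_of_coords z i :
  row i (matrix_of_coords z) = \sum_l z (i, l) *: row l (A i).
Proof.
rewrite rowK; apply/rowP => j; rewrite !mxE summxE; apply: eq_bigr => l _.
by rewrite !mxE.
Qed.

Lemma mul_matrix_of_coords (u : 'rV[R]_n) z :
  u *m matrix_of_coords z =
  lincomb (fun k => u 0 k.1 *: row k.2 (A k.1)) (index_enum _) z.
Proof.
rewrite mulmx_sum_row /lincomb.
rewrite (eq_bigr (fun k => z (k.1, k.2) *: (u 0 k.1 *: row k.2 (A k.1)))); last by case.
rewrite -(pair_bigA _ (fun i l => z (i, l) *: (u 0 i *: row l (A i)))) /=.
apply: eq_bigr => i _; rewrite row_matrix_of_coords scaler_sumr.
by apply: eq_bigr => l _; rewrite !scalerA mulrC.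
Qed.

Lemma tr_mul_rows (M : 'M[R]_p) : M^T *m M = \sum_l (row l M)^T *m row l M.
Proof.
apply/matrixP => a b; rewrite mxE summxE; apply: eq_bigr => l _.
by rewrite !mxE big_ord1 !mxE.
Qed.

(** The rows of the mixture are uncorrelated with covariance [Sigma], so that
    [u *m X] has covariance [sqnorm u *: Sigma]. *)
Lemma scatter_rows (u : 'rV[R]_n) (Sigma : 'M[R]_p) :
  (forall i, (A i)^T *m A i = Sigma) ->
  scatter (fun k => u 0 k.1 *: row k.2 (A k.1)) (index_enum _) = sqnorm u *: Sigma.
Proof.
move=> AS; rewrite /scatter.
rewrite -(pair_bigA _ (fun i l => (u 0 i *: row l (A i))^T *m (u 0 i *: row l (A i)))) /=.
rewrite /sqnorm scaler_suml; apply: eq_bigr => i _.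
rewrite -(AS i) tr_mul_rows scaler_sumr; apply: eq_bigr => l _.
rewrite -scalemxAr; have -> : (u 0 i *: row l (A i))^T = u 0 i *: (row l (A i))^T by rewrite linearZ.
by rewrite -scalemxAl scalerA expr2.
Qed.

End RowMixture.

Section MeasureAux.
Context d (T : measurableType d) (R : realType) (P : probability T R).

Lemma measurable_superlevel (f : T -> R) (rho : R) : measurable_fun setT f ->
  measurable [set w | (rho <= f w)%R].
Proof.
move=> mf; rewrite (_ : [set w | _] = setT `&` f @^-1` `[rho, +oo[%classic).
  by apply: mf => //; exact: measurable_itv.
by rewrite setTI; apply/seteqP; split => w /=; rewrite in_itv /= andbT.
Qed.

Lemma markov_expR (f : T -> R) (rho : R) : measurable_fun setT f ->
  (P [set w | (rho <= f w)%R] <= (expR (- rho))%:E * \int[P]_w (expR (f w))%:E)%E.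
Proof.
move=> mf; have mS := measurable_superlevel rho mf.
have mexp : measurable_fun setT (fun w => (expR (f w))%:E).
  by apply/measurable_EFinP; apply: measurableT_comp.
rewrite -ge0_integralZl//.
rewrite -(setIT [set w | _]) -integral_indic//.
apply: ge0_le_integralT => w; first by rewrite lee_fin.
rewrite -EFinM lee_fin -expRD indicE; case: (boolP (w \in _)) => [|_].
  by rewrite inE /= => h; rewrite -expR0 ler_expR addrC subr_ge0.
exact: expR_ge0.
Qed.

End MeasureAux.

Section Tails.
Context d (T : measurableType d) (R : realType) (P : probability T R).
Variables (n p : nat) (A : 'I_n -> 'M[R]_p) (Z : 'I_n * 'I_p -> {RV P >-> R}).
Variables (Sigma : 'M[R]_p) (c_m c_M : R).
Hypotheses (p0 : (0 < p)%N) (cm0 : 0 < c_m) (cM0 : 0 < c_M).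
Hypotheses (iidZ : iid_normal Z) (AS : forall i, (A i)^T *m A i = Sigma).
Hypothesis symS : Sigma^T = Sigma.
Hypothesis Sigma_ge : forall v, c_m * sqnorm v <= qform Sigma v.
Hypothesis Sigma_le : forall v, qform Sigma v <= c_M * sqnorm v.

Let X w := matrix_of_coords A (Z ^~ w).

Lemma measurable_sqnorm_mul_coords u : measurable_fun setT (fun w => sqnorm (u *m X w)).
Proof.
rewrite (_ : (fun w => _) = (fun w => sqnorm (lincomb
    (fun k => u 0 k.1 *: row k.2 (A k.1)) (index_enum _) (Z ^~ w)))).
  apply: measurable_sqnorm => j.
  by apply: (@measurable_lincomb _ _ _ _ _ _ _ (fun i w => Z i w)) => i.
by apply/funext => w; rewrite mul_matrix_of_coords.
Qed.

(** Bounds the determinant ratio of [integral_expR_qform_lincomb], taken at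
    [H = h%:M], by the extreme eigenvalues. *)
Lemma laplace_coords u (h e : R) c : (e == 1) || (e == -1) -> 0 < h -> 0 < c ->
  (forall v, c * sqnorm v <= qform (h%:M + (e * sqnorm u) *: Sigma) v) ->
  (\int[P]_w (expR (- e / (2 * h) * sqnorm (u *m X w)))%:E <=
   (Num.sqrt (h / c) ^+ p)%:E)%E.
Proof.
move=> e1 h0 c0 cS; set b := fun k : 'I_n * 'I_p => u 0 k.1 *: row k.2 (A k.1).
have := @integral_expR_qform_lincomb _ _ _ _ _ _ iidZ _ b _ e1 (index_enum _) h%:M (Num.min h c).
rewrite index_enum_uniq tr_scalar_mx lt_min h0 c0 => /(_ isT erefl isT).
rewrite /b (scatter_rows u AS) scalerA => H.
have {}H := H _ (fun v => le_trans _ (cS v)).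
rewrite (_ : (fun w => _) = (fun w => (expR (- e / 2 * qform (invmx h%:M)
   (lincomb b (index_enum _) (Z ^~ w))))%:E)); last first.
  apply/funext => w; rewrite mul_matrix_of_coords; congr (expR _)%:E.
  by rewrite invmx_scalar qform_scalar; field; rewrite gt_eqF.
rewrite /b H; last 2 first.
- by move=> v; rewrite qform_scalar ler_wpM2r ?sqnorm_ge0// ge_min lexx.
- by move=> v; rewrite ler_wpM2r ?sqnorm_ge0// ge_min lexx orbT.
rewrite lee_fin det_scalar.
have dge : c ^+ p <= \det (h%:M + (e * sqnorm u) *: Sigma).
  apply: det_ge => //; last exact: ltW.
  by rewrite linearD linearZ /= tr_scalar_mx symS.
have cp : 0 < c ^+ p by rewrite exprn_gt0.
rewrite -(@ler_pXn2r _ 2)// ?nnegrE ?sqrtr_ge0 ?exprn_ge0 ?sqrtr_ge0//.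
rewrite sqr_sqrtr; last by rewrite divr_ge0 ?exprn_ge0 ?(ltW h0)// (le_trans _ dge) ?ltW.
rewrite exprAC sqr_sqrtr ?divr_ge0 ?(ltW h0) ?(ltW c0)//.
rewrite expr_div_n ler_wpM2l ?exprn_ge0 ?(ltW h0)// lef_pV2// posrE//.
exact: lt_le_trans dge.
Qed.

(** Markov's inequality for [exp(- |uX|^2 / (2 h))] with the optimal
    [h = rho / p]. The exponent p, rather than one independent of the dimension,
    is what beats the size of a net. *)
Lemma prob_sqnorm_mul_le u rho : 0 < rho -> 0 < sqnorm u ->
  (P [set w | (sqnorm (u *m X w) <= rho)%R] <=
   ((2 * Num.sqrt (rho / (p%:R * (sqnorm u * c_m)))) ^+ p)%:E)%E.
Proof.
move=> rho0 u0; have pR : 0 < p%:R :> R by rewrite ltr0n.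
pose h := rho / p%:R; have h0 : 0 < h by rewrite divr_gt0.
have uc : 0 < sqnorm u * c_m by rewrite mulr_gt0.
have mX := measurable_sqnorm_mul_coords u.
have mf : measurable_fun setT (fun w => - 1 / (2 * h) * sqnorm (u *m X w)).
  exact: measurable_funM.
have h2 : 0 < 2 * h by rewrite mulr_gt0.
rewrite (_ : [set w | _] = [set w | - (rho / (2 * h)) <= - 1 / (2 * h) * sqnorm (u *m X w)]); last first.
  apply/seteqP; split => w /=; rewrite mulN1r mulNr lerN2 [_^-1 * _]mulrC.
    by move=> ?; rewrite ler_pM2r ?invr_gt0.
  by rewrite ler_pM2r ?invr_gt0.
apply: (le_trans (markov_expR _ _ mf)); rewrite opprK.
have := @laplace_coords u h 1 (sqnorm u * c_m); rewrite eqxx mul1r => /(_ isT h0 uc) L.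
apply: (@le_trans _ _ ((expR (rho / (2 * h)))%:E * (Num.sqrt (h / (sqnorm u * c_m)) ^+ p)%:E)%E).
  rewrite lee_wpmul2l ?lee_fin ?expR_ge0//; apply: L => v.
  rewrite qformD qformZ qform_scalar.
  have := mulr_ge0 (ltW h0) (sqnorm_ge0 v).
  have := ler_wpM2l (sqnorm_ge0 u) (Sigma_ge v); lra.
rewrite -EFinM lee_fin exprMn.
have -> : expR (rho / (2 * h)) = expR (1 / 2) ^+ p.
  by rewrite -expRM_natl; congr expR; rewrite /h; field; rewrite !gt_eqF.
rewrite (_ : h / _ = rho / (p%:R * (sqnorm u * c_m))); last first.
  by rewrite /h; field; rewrite !gt_eqF.
rewrite ler_wpM2r ?exprn_ge0 ?sqrtr_ge0// lerXn2r ?nnegrE ?expR_ge0//.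
by apply: (le_trans (expR_le1D2x _)); lra.
Qed.

(** Markov's inequality for [exp(|uX|^2 / (2 h))], where [h = 2 |u|^2 c_M] is
    twice the largest eigenvalue of the covariance of [u *m X], so that the
    transform is finite. *)
Lemma prob_sqnorm_mul_ge u rho : 0 < rho -> 0 < sqnorm u ->
  (P [set w | (rho <= sqnorm (u *m X w))%R] <=
   ((8 * (sqnorm u * c_M) * p%:R / rho) ^+ p)%:E)%E.
Proof.
move=> rho0 u0; have pR : 0 < p%:R :> R by rewrite ltr0n.
have uc : 0 < sqnorm u * c_M by rewrite mulr_gt0.
pose h := 2 * (sqnorm u * c_M); have h0 : 0 < h by rewrite mulr_gt0.
have mX := measurable_sqnorm_mul_coords u.
have h2 : 0 < 2 * h by rewrite mulr_gt0.
have mf : measurable_fun setT (fun w => - (-1) / (2 * h) * sqnorm (u *m X w)).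
  exact: measurable_funM.
rewrite (_ : [set w | _] = [set w | rho / (2 * h) <= - (-1) / (2 * h) * sqnorm (u *m X w)]); last first.
  by apply/seteqP; split => w /=; rewrite opprK mul1r [_^-1 * _]mulrC ler_pM2r ?invr_gt0.
apply: (le_trans (markov_expR _ _ mf)).
have := @laplace_coords u h (-1) (sqnorm u * c_M); rewrite eqxx orbT => /(_ isT h0 uc) L.
apply: (@le_trans _ _ ((expR (- (rho / (2 * h))))%:E * (Num.sqrt (h / (sqnorm u * c_M)) ^+ p)%:E)%E).
  rewrite lee_wpmul2l ?lee_fin ?expR_ge0//; apply: L => v.
  rewrite qformD qformZ qform_scalar mulN1r mulNr lerBrDr /h.
  have := ler_wpM2l (sqnorm_ge0 u) (Sigma_le v); lra.
rewrite -EFinM lee_fin.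
have -> : h / (sqnorm u * c_M) = 2 by rewrite /h; field; rewrite !gt_eqF.
have s2 : Num.sqrt 2 <= 2 :> R.
  have := @sqr_sqrtr R 2 (ler0n _ _); have := sqrtr_ge0 (2 : R); nra.
set x := rho / (2 * h) / p%:R.
have x0 : 0 < x by rewrite !divr_gt0.
have -> : - (rho / (2 * h)) = p%:R * - x by rewrite /x; field; rewrite !gt_eqF.
rewrite expRM_natl -exprMn lerXn2r ?nnegrE//.
- by rewrite ltW// divr_gt0// !mulr_gt0.
apply: (@le_trans _ _ (x^-1 * 2)).
  rewrite ler_pM ?expR_ge0 ?sqrtr_ge0//.
  rewrite expRN lef_pV2 ?posrE ?expR_gt0//.
  by have := expR_ge1Dx x; lra.
by rewrite /x /h le_eqVlt; apply/orP; left; apply/eqP; field; rewrite !gt_eqF.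
Qed.

End Tails.

(** * Second moments with independent coefficients *)

Section SecondMoment.
Context d (T : measurableType d) (R : realType) (P : probability T R).
Context {I : finType} (Z : I -> {RV P >-> R}).
Hypothesis iidZ : iid_normal Z.
Notation N01 := (@normal_prob R 0 1).

Lemma integral_normal_sqnorm_le m (y v : 'rV[R]_m) (g : R) : 0 <= g ->
  (\int[N01]_x (sqnorm (y + x *: v) + g)%:E <= (sqnorm y + 8 * sqnorm v + g)%:E)%E.
Proof.
move=> g0; pose c := \sum_j y 0 j * v 0 j.
have E x : sqnorm (y + x *: v) + g = (sqnorm y + g) + 2 * c * x + sqnorm v * x ^+ 2.
  suff -> : sqnorm (y + x *: v) = sqnorm y + 2 * c * x + sqnorm v * x ^+ 2 by ring.
  rewrite /sqnorm /c mulr_sumr !mulr_suml -!big_split /=.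
  by apply: eq_bigr => j _; rewrite !mxE; ring.
under eq_integral do rewrite E.
rewrite addrAC; apply: integral_normal_quad_le; first exact: sqnorm_ge0.
by move=> x; rewrite -E addr_ge0// sqnorm_ge0.
Qed.

Variables (m : nat) (V : I -> (I -> R) -> 'rV[R]_m).
Hypothesis mV : forall k j, borel_functional (fun z => V k z 0 j).

Lemma borel_sqnorm_combination s g : borel_functional g ->
  borel_functional (fun z => sqnorm (\sum_(k <- s) z k *: V k z) + g z).
Proof.
move=> mg d' U Y mY; apply: measurable_funD; last exact: mg.
apply: measurable_sqnorm => j.
rewrite (_ : (fun u => _) = (fun u => \sum_(k <- s) Y k u * V k (Y ^~ u) 0 j)).
  by apply: measurable_sum => k; apply: measurable_funM; [exact: mY|exact: mV].
by apply/funext => u; rewrite summxE; apply: eq_bigr => k _; rewrite mxE.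
Qed.

(** If the coefficients do not depend on the coordinates they multiply, the
    cross terms integrate to zero and only the diagonal terms remain. The
    coordinates of s are integrated one by one; g collects the diagonal terms
    already produced. The factor 8 is that of [integral_normal_quad_le]. *)
Lemma integral_sqnorm_combination_le (s : seq I) (g : (I -> R) -> R) :
  uniq s ->
  (forall k l z x, k \in s -> l \in s -> V k (upd z l x) = V k z) ->
  borel_functional g -> (forall z, 0 <= g z) ->
  (forall l z x, l \in s -> g (upd z l x) = g z) ->
  (\int[P]_w (sqnorm (\sum_(k <- s) Z k w *: V k (Z ^~ w)) + g (Z ^~ w))%:E <=
   \int[P]_w (8 * \sum_(k <- s) sqnorm (V k (Z ^~ w)) + g (Z ^~ w))%:E)%E.
Proof.
elim: s g => [|k s IH] g /=.
  move=> _ _ mg g0 _; apply: ge0_le_integralT => w; rewrite lee_fin !big_nil.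
    by rewrite addr_ge0// sqnorm_ge0.
  by rewrite mulr0 lerD2r /sqnorm big1// => j _; rewrite mxE expr0n.
move=> /andP[ks us] Vs mg g0 gs.
pose Phi z := sqnorm (\sum_(k <- k :: s) z k *: V k z) + g z.
have mPhi : borel_functional Phi by exact: borel_sqnorm_combination.
rewrite (coordinate_fubini iidZ k mPhi); last by move=> z; rewrite addr_ge0// sqnorm_ge0.
pose g' z := 8 * sqnorm (V k z) + g z.
apply: (@le_trans _ _
  (\int[P]_w (sqnorm (\sum_(k <- s) Z k w *: V k (Z ^~ w)) + g' (Z ^~ w))%:E)%E).
  apply: ge0_le_integralT => w.
    by apply: integral_ge0 => x _; rewrite lee_fin addr_ge0// sqnorm_ge0.
  pose y := \sum_(l <- s) Z l w *: V l (Z ^~ w).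
  rewrite (_ : sqnorm _ + g' _ = sqnorm y + 8 * sqnorm (V k (Z ^~ w)) + g (Z ^~ w));
    last by rewrite addrA.
  rewrite (_ : (fun x => _) = (fun x => (sqnorm (y + x *: V k (Z ^~ w)) + g (Z ^~ w))%:E)).
    exact: integral_normal_sqnorm_le.
  apply/funext => x; rewrite /Phi gs ?mem_head//; congr (sqnorm _ + _)%:E.
  rewrite big_cons /upd eqxx addrC -/(upd (Z ^~ w) k x) Vs ?mem_head//; congr (_ + _).
  rewrite /y big_seq [RHS]big_seq; apply: eq_bigr => l ls.
  rewrite Vs ?mem_head ?inE ?ls ?orbT//; congr (_ *: _).
  by rewrite /upd; case: eqP => // lk; move: ks; rewrite -lk ls.
apply: le_trans (IH g' us _ _ _ _) _.
- by move=> k' l z x k's ls; apply: Vs; rewrite inE ?k's ?ls orbT.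
- move=> d' U Y mY; apply: measurable_funD; last exact: mg.
  by apply: measurable_funM => //; apply: measurable_sqnorm => j; exact: mV.
- by move=> z; rewrite addr_ge0// mulr_ge0// sqnorm_ge0.
- move=> l z x ls; rewrite /g' Vs ?mem_head ?inE ?ls ?orbT// gs// inE ls orbT//.
apply: ge0_le_integralT => w; rewrite lee_fin.
  rewrite /g' addr_ge0 ?addr_ge0 ?mulr_ge0 ?sqnorm_ge0 ?g0//.
  by rewrite sumr_ge0// => l _; exact: sqnorm_ge0.
by rewrite big_cons /g'; lra.
Qed.

End SecondMoment.

(** * Ridge matrices *)

Section Ridge.
Context {R : realType}.

(** The squared Frobenius norm. *)
Definition sqfro m p (M : 'M[R]_(m, p)) : R := \sum_i sqnorm (row i M).

Lemma sqfro_ge0 m p (M : 'M[R]_(m, p)) : 0 <= sqfro M.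
Proof. by rewrite sumr_ge0// => i _; exact: sqnorm_ge0. Qed.

Lemma sqfro_tr m p (M : 'M[R]_(m, p)) : sqfro M^T = sqfro M.
Proof.
rewrite /sqfro /sqnorm [RHS](eq_bigr (fun i => \sum_j M i j ^+ 2)); last first.
  by move=> i _; apply: eq_bigr => j _; rewrite mxE.
rewrite [RHS]exchange_big; apply: eq_bigr => j _; apply: eq_bigr => i _.
by rewrite !mxE.
Qed.

Lemma sqnorm_sub_scale m (a b : 'rV[R]_m) (s c : R) :
  sqnorm (s *: a - c *: b) =
  s ^+ 2 * sqnorm a - 2 * (s * c) * (a *m b^T) 0 0 + c ^+ 2 * sqnorm b.
Proof.
rewrite mxE /sqnorm !mulr_sumr -sumrB -big_split /=.
by apply: eq_bigr => j _; rewrite !mxE; ring.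
Qed.

Lemma cauchy_schwarz m (a b : 'rV[R]_m) :
  ((a *m b^T) 0 0) ^+ 2 <= sqnorm a * sqnorm b.
Proof.
have [->|b0] := eqVneq b 0; first by rewrite trmx0 mulmx0 mxE expr0n mulr_ge0 ?sqnorm_ge0.
have sb : 0 < sqnorm b by rewrite lt_neqAle sqnorm_ge0 andbT eq_sym sqnorm_eq0.
have := sqnorm_ge0 (sqnorm b *: a - (a *m b^T) 0 0 *: b).
rewrite sqnorm_sub_scale; move: sb.
move: (sqnorm a) (sqnorm b) ((a *m b^T) 0 0) => x y c y0 h.
rewrite -(ler_pM2l y0); move: h.
have -> : y ^+ 2 * x - 2 * (y * c) * c + c ^+ 2 * y = y * (x * y) - y * c ^+ 2 by ring.
by rewrite subr_ge0.
Qed.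

Lemma sqnorm_mulmx_le m p (v : 'rV[R]_m) (M : 'M[R]_(m, p)) :
  sqnorm (v *m M) <= sqnorm v * sqfro M.
Proof.
rewrite -(sqfro_tr M) /sqfro mulr_sumr /sqnorm; apply: ler_sum => j _.
rewrite -/(sqnorm v) -/(sqnorm (row j M^T)); apply: le_trans (cauchy_schwarz _ _).
rewrite le_eqVlt; apply/orP; left; apply/eqP; congr (_ ^+ 2); rewrite !mxE.
by apply: eq_bigr => i _; rewrite !mxE.
Qed.

Lemma sqfro_mulmx m p q (M : 'M[R]_(m, p)) (N : 'M[R]_(p, q)) :
  sqfro (M *m N) = \sum_j qform (M^T *m M) (row j N^T).
Proof.
rewrite -sqfro_tr trmx_mul /sqfro; apply: eq_bigr => j _.
by rewrite row_mul qform_tr_mul.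
Qed.

Section RidgeMatrix.
Variables (k p : nat) (C : 'M[R]_(k, p)) (tau : R).
Hypothesis tau0 : 0 < tau.

(** As tau tends to 0 this tends to the orthogonal projection onto the kernel
    of C, but it depends measurably on C, with no case distinction on the
    rank. *)
Definition ridge : 'M[R]_p := tau *: invmx (tau%:M + C^T *m C).

Let K := tau%:M + C^T *m C.

Let symK : K^T = K.
Proof. by rewrite /K linearD /= tr_scalar_mx trmx_mul trmxK. Qed.

Let qformK u : qform K u = tau * sqnorm u + sqnorm (u *m C^T).
Proof. by rewrite /K qformD qform_scalar qform_tr_mul. Qed.

Lemma det_ridge_gt0 : 0 < \det K.
Proof. by apply: (det_gt0 symK tau0) => u; rewrite qformK lerDl sqnorm_ge0. Qed.

Let Ku : K \in unitmx. Proof. by rewrite unitmxE unitfE gt_eqF// det_ridge_gt0. Qed.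

Lemma tr_ridge : ridge^T = ridge.
Proof. by rewrite /ridge linearZ /= trmx_inv -/K symK. Qed.

Lemma ridge_mul : ridge *m K = tau%:M.
Proof. by rewrite /ridge -scalemxAl mulVmx// scalemx1. Qed.

(** The j-th diagonal entry of [N K N = tau N], where [K = tau + C^T C]. *)
Lemma row_ridge j :
  tau * sqnorm (row j ridge) + sqnorm (row j ridge *m C^T) = tau * ridge j j.
Proof.
rewrite -qformK /qform -row_mul ridge_mul -/K.
have -> : row j (tau%:M : 'M[R]_p) = tau *: delta_mx 0 j.
  by apply/rowP => i; rewrite !mxE /= eq_sym; case: eqP; rewrite ?mulr1 ?mulr0.
rewrite -scalemxAl mxE -rowE; congr (_ * _).
by rewrite -[ridge]tr_ridge -tr_col trmxK !mxE.
Qed.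

Lemma ridge_diag j : sqnorm (row j ridge) <= ridge j j <= 1.
Proof.
have h := row_ridge j; have g0 := sqnorm_ge0 (row j ridge *m C^T).
have h1 : sqnorm (row j ridge) <= ridge j j by rewrite -(ler_pM2l tau0); lra.
rewrite h1 /=; have : ridge j j ^+ 2 <= ridge j j.
  apply: le_trans h1; rewrite /sqnorm (bigD1 j)//= [X in _ <= X ^+ 2 + _]mxE.
  rewrite lerDl sumr_ge0// => i _.
  exact: sqr_ge0.
have [//|r1] := leP (ridge j j) 1; nra.
Qed.

Lemma sqfro_mul_ridge : sqfro (C *m ridge) <= tau * p%:R.
Proof.
rewrite -sqfro_tr trmx_mul tr_ridge /sqfro -[p in p%:R]card_ord -sum1_card natr_sum mulr_sumr.
apply: ler_sum => j _; rewrite row_mul mulr1.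
have := row_ridge j; have /andP[_ r1] := ridge_diag j.
have := mulr_ge0 (ltW tau0) (sqnorm_ge0 (row j ridge)).
have := ler_wpM2l (ltW tau0) r1; lra.
Qed.

(** C has fewer rows than columns, so its kernel is nonzero, and the ridge
    fixes it pointwise. *)
Lemma sqfro_ridge_ge1 : (k < p)%N -> 1 <= sqfro ridge.
Proof.
move=> kp; have [v v0 vC] : exists2 v : 'rV[R]_p, v != 0 & v *m C^T = 0.
  have : kermx C^T != 0.
    rewrite -mxrank_eq0 mxrank_ker -lt0n subn_gt0 (leq_ltn_trans _ kp)//.
    exact: rank_leq_col.
  case/rowV0Pn => v /sub_kermxP vC v0; by exists v.
have vN : v *m ridge = v.
  have vK : v *m K = tau *: v by rewrite /K mulmxDr mul_mx_scalar mulmxA vC mul0mx addr0.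
  by rewrite /ridge -scalemxAr scalemxAl -vK mulmxK.
have := sqnorm_mulmx_le v ridge; rewrite vN.
have sv : 0 < sqnorm v by rewrite lt_neqAle sqnorm_ge0 andbT eq_sym sqnorm_eq0.
by rewrite -[X in X <= _]mulr1 ler_pM2l.
Qed.

Lemma sqfro_ridge_gt0 : (0 < p)%N -> 0 < sqfro ridge.
Proof.
move=> p0; rewrite lt_neqAle sqfro_ge0 andbT eq_sym psumr_eq0; last first.
  by move=> i _; exact: sqnorm_ge0.
apply/allPn; exists (Ordinal p0); rewrite ?mem_index_enum//= sqnorm_eq0.
apply/eqP => r0; have := congr1 (mulmxr K) r0.
rewrite /= -row_mul ridge_mul mul0mx => /rowP/(_ (Ordinal p0)).
by rewrite !mxE eqxx => /eqP; rewrite gt_eqF.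
Qed.

(** Since [0 <= N <= 1], the squared Frobenius norm is at most the trace. By
    the push-through identity [N = 1 - C^T W^-1 C] with [W = tau + C C^T], the
    trace equals [p - k + tau tr (W^-1)], and [W >= tau + L]. *)
Lemma sqfro_ridge_le (L : R) : (k <= p)%N -> 0 <= L ->
  (forall c : 'rV[R]_k, L * sqnorm c <= sqnorm (c *m C)) ->
  sqfro ridge <= (p - k)%:R + k%:R * (tau / (tau + L)).
Proof.
move=> kp L0 CL; pose W := tau%:M + C *m C^T.
have symW : W^T = W by rewrite /W linearD /= tr_scalar_mx trmx_mul trmxK.
have qformW u : qform W u = tau * sqnorm u + sqnorm (u *m C).
  by rewrite /W qformD qform_scalar -{1}(trmxK C) qform_tr_mul trmxK.
have tL : 0 < tau + L by rewrite ltr_wpDr.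
have Wge u : (tau + L) * sqnorm u <= qform W u.
  by rewrite qformW mulrDl lerD2l.
have Wu : W \in unitmx by rewrite unitmxE unitfE gt_eqF// (det_gt0 symW tL).
have symWi : (invmx W)^T = invmx W by rewrite trmx_inv symW.
have Wdiag i : invmx W i i <= (tau + L)^-1.
  set y := row i (invmx W).
  have yW : qform W y = invmx W i i.
    rewrite /qform -row_mul mulVmx// row1 -rowE.
    by rewrite /y -[in LHS]symWi -tr_col trmxK !mxE.
  have := Wge y; rewrite yW => h.
  have : (tau + L) * invmx W i i ^+ 2 <= invmx W i i.
    apply: le_trans h; rewrite ler_pM2l// /sqnorm (bigD1 i)//= mxE lerDl.
    by rewrite sumr_ge0// => j _; exact: sqr_ge0.
  rewrite -[X in _ -> _ <= X]mul1r ler_pdivlMr//.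
  have [//|r1] := leP (invmx W i i * (tau + L)) 1; nra.
have NE : ridge = 1%:M - C^T *m invmx W *m C.
  have : (1%:M - C^T *m invmx W *m C) *m K = ridge *m K.
    rewrite ridge_mul mulmxBl mul1mx -!mulmxA.
    have -> : C *m K = W *m C.
      by rewrite /K /W mulmxDr mulmxDl mul_mx_scalar mul_scalar_mx mulmxA.
    by rewrite mulKmx// /K addrK.
  by move=> /(congr1 (mulmxr (invmx K))) /=; rewrite !mulmxK.
apply: (@le_trans _ _ (\tr ridge)).
  by apply: ler_sum => j _; case/andP: (ridge_diag j).
rewrite NE linearB /= mxtrace1 mxtrace_mulC mulmxA.
have -> : C *m C^T = W - tau%:M by rewrite /W addrC addKr.
rewrite mulmxBl mulmxV// linearB /= mxtrace1 mul_scalar_mx linearZ /=.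
rewrite natrB//.
have : \tr (invmx W) <= k%:R * (tau + L)^-1.
  rewrite -[k in k%:R]card_ord -sum1_card natr_sum mulr_suml.
  by apply: ler_sum => j _; rewrite mul1r.
move=> /(ler_wpM2l (ltW tau0)); rewrite mulrCA => h.
by lra.
Qed.

End RidgeMatrix.
End Ridge.

(** * Rows tested against the ridge of other rows *)

Section MeasurableMatrices.
Context d (U : measurableType d) (R : realType).

Definition measurable_entries m p (M : U -> 'M[R]_(m, p)) : Prop :=
  forall i j, measurable_fun setT (fun u => M u i j).

Lemma measurable_det m (M : U -> 'M[R]_m) : measurable_entries M ->
  measurable_fun setT (fun u => \det (M u)).
Proof.
move=> mM; apply: measurable_sum => s; apply: measurable_funM => //.
by apply: measurable_prod => i _; exact: mM.
Qed.

Lemma measurable_invr (f : U -> R) : measurable_fun setT f -> (forall u, 0 < f u) ->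
  measurable_fun setT (fun u => (f u)^-1).
Proof.
move=> mf f0; rewrite (_ : (fun u => _) = (fun u => f u `^ (- 1))).
  by apply: (measurableT_comp (f := fun x : R => x `^ (-1))) => //; exact: measurable_powR.
by apply/funext => u; rewrite powR_inv1// ltW.
Qed.

Lemma measurable_invmx m (M : U -> 'M[R]_m) : measurable_entries M ->
  (forall u, 0 < \det (M u)) -> measurable_entries (fun u => invmx (M u)).
Proof.
move=> mM dM i j.
rewrite (_ : (fun u => _) = (fun u => (\det (M u))^-1 * cofactor (M u) j i)).
  apply: measurable_funM; first by apply: measurable_invr => //; exact: measurable_det.
  apply: measurable_funM => //; apply: measurable_det => a b.
  rewrite (_ : (fun u => _) = (fun u => M u (lift j a) (lift i b))) //.
  by apply/funext => u; rewrite !mxE.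
apply/funext => u; rewrite /invmx unitmxE unitfE gt_eqF//= mxE.
by rewrite mxE.
Qed.

Lemma measurable_ridge k p (C : U -> 'M[R]_(k, p)) tau : 0 < tau ->
  measurable_entries C -> measurable_entries (fun u => ridge (C u) tau).
Proof.
move=> tau0 mC i j; rewrite /ridge.
rewrite (_ : (fun u => _) = (fun u => tau * invmx (tau%:M + (C u)^T *m C u) i j)); last first.
  by apply/funext => u; rewrite mxE.
apply: measurable_funM => //; apply: measurable_invmx => [a b|u]; last exact: det_ridge_gt0.
rewrite (_ : (fun u => _) = (fun u => (tau%:M : 'M[R]_p) a b + ((C u)^T *m C u) a b)); last first.
  by apply/funext => u; rewrite mxE.
apply: measurable_funD => //; apply: (@measurable_mulmx _ _ _ _ _ _ (fun u => (C u)^T) C) => // x y.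
rewrite (_ : (fun u => _) = (fun u => C u y x)) //.
by apply/funext => u; rewrite mxE.
Qed.

Lemma measurable_sqfro m p (M : U -> 'M[R]_(m, p)) : measurable_entries M ->
  measurable_fun setT (fun u => sqfro (M u)).
Proof.
move=> mM; apply: measurable_sum => i; apply: measurable_sqnorm => j.
rewrite (_ : (fun u => _) = (fun u => M u i j)) //.
by apply/funext => u; rewrite mxE.
Qed.

End MeasurableMatrices.

Section Leak.
Context {R : realType}.
Variables (n p k : nat) (f : 'I_k -> 'I_n) (tau : R).

(** How much of the i-th row survives the ridge of the rows selected by f,
    relative to the size of that ridge. For an unselected row the quotient has
    mean at most [8 c_M], however the selected rows are chosen. *)
Definition row_leak (X : 'M[R]_(n, p)) (i : 'I_n) : R :=
  sqnorm (row i X *m ridge (rowsub f X) tau) / sqfro (ridge (rowsub f X) tau).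

Definition leak (X : 'M[R]_(n, p)) : R := \sum_(i | i \notin codom f) row_leak X i.

Lemma row_leak_ge0 X i : 0 <= row_leak X i.
Proof. by rewrite divr_ge0 ?sqnorm_ge0 ?sqfro_ge0. Qed.

Lemma leak_ge0 X : 0 <= leak X.
Proof. by rewrite sumr_ge0// => i _; exact: row_leak_ge0. Qed.

End Leak.

Section LeakLowerBounds.
Context {R : realType}.

(** [X_0 N] is a combination of the rows of X in which [X_0] has coefficient 1,
    so [|X_0 N|^2 >= L]. The choice of tau makes [n tau / (tau + L) <= 1], so
    [sqfro_ridge_le] for the n selected rows gives [|N|_F^2 <= p - n + 1]. *)
Lemma leak_wide n p (X : 'M[R]_(n.+1, p)) (L : R) : (n.+1 <= p)%N -> 0 < L ->
  L <= s_min X ^+ 2 ->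
  L / (p - n.+1).+2%:R <= leak (lift ord0) (L / (2 * (n.+1 + p)%:R)) X.
Proof.
move=> np L0 LX; set tau := L / (2 * _).
have np0 : 0 < (n.+1 + p)%:R :> R by rewrite ltr0n.
have tau0 : 0 < tau by rewrite divr_gt0// mulr_gt0.
have p0 : (0 < p)%N by exact: leq_trans np.
set C := rowsub (lift ord0) X.
have XL u : L * sqnorm u <= sqnorm (u *m X).
  by apply: le_trans (s_min_row _ _ _ np) => //; rewrite ler_wpM2r ?sqnorm_ge0.
have CX a (c : 'rV[R]_n) : L * (a ^+ 2 + sqnorm c) <= sqnorm (a *: row ord0 X + c *m C).
  pose u : 'rV[R]_n.+1 := \row_i (if unlift ord0 i is Some j then c 0 j else a).
  have u0 : u 0 ord0 = a by rewrite mxE unlift_none.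
  have uj j : u 0 (lift ord0 j) = c 0 j by rewrite mxE liftK.
  have -> : a ^+ 2 + sqnorm c = sqnorm u.
    rewrite /sqnorm big_ord_recl u0; congr (_ + _).
    by apply: eq_bigr => j _; rewrite uj.
  have -> : a *: row ord0 X + c *m C = u *m X; last exact: XL.
  rewrite (mulmx_sum_row u) big_ord_recl u0; congr (_ + _).
  rewrite mulmx_sum_row; apply: eq_bigr => j _; rewrite uj; congr (_ *: _).
  by apply/rowP => i; rewrite !mxE.
set N := ridge C tau.
have froN : sqfro N <= (p - n.+1).+2%:R.
  apply: (le_trans (sqfro_ridge_le tau0 _ (ltW L0) _)).
  - exact: ltnW.
  - by move=> c; have := CX 0 c; rewrite expr0n add0r scale0r add0r.
  have -> : (p - n = (p - n.+1).+1)%N by rewrite subnSK.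
  rewrite -[X in _ <= X%:R]addn1 natrD lerD2l.
  have tL : 0 < tau + L by rewrite addr_gt0.
  rewrite mulrA ler_pdivrMr// mul1r.
  have : n%:R * tau <= L.
    rewrite /tau mulrA ler_pdivrMr ?mulr_gt0//.
    have nn : n%:R <= (n.+1 + p)%:R :> R by rewrite ler_nat (leq_trans (leqnSn n))// leq_addr.
    have := ler_wpM2l (ltW L0) nn; have := mulr_gt0 L0 np0; lra.
  by lra.
(* N = 1 - tau^-1 N C^T C, by ridge_mul. *)
have XN : L <= sqnorm (row ord0 X *m N).
  have NE : row ord0 X *m N = 1 *: row ord0 X + (- (tau^-1 *: (row ord0 X *m N *m C^T))) *m C.
    have := congr1 (mulmx (row ord0 X)) (ridge_mul C tau0).
    rewrite mulmxA -/N mulmxDr !mul_mx_scalar => /(congr1 (fun M => tau^-1 *: M)).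
    rewrite scalerDr !scalerA mulVf ?gt_eqF// !scale1r => E.
    by apply/eqP; rewrite mulNmx -scalemxAl eq_sym subr_eq; move: E; rewrite mulmxA => ->.
  rewrite NE; apply: le_trans (CX _ _); rewrite expr1n mulrDr mulr1 lerDl.
  by rewrite mulr_ge0 ?sqnorm_ge0 ?ltW.
have f0 : 0 < sqfro N by exact: sqfro_ridge_gt0.
rewrite /leak (big_pred1 ord0) => [|i].
  rewrite /row_leak -/C -/N ler_pM ?invr_ge0 ?(ltW L0)//.
  by rewrite lef_pV2 ?posrE.
rewrite /=; case: (unliftP ord0 i) => [j ->|->].
  by rewrite codom_f /= eq_sym (negbTE (neq_lift _ _)).
by rewrite eqxx; apply/codomP => -[j] /eqP; rewrite (negbTE (neq_lift _ _)).
Qed.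

(** On the whole matrix [|X N|_F^2 >= L |N|_F^2], whereas the selected rows
    contribute at most [|C N|_F^2 <= tau p <= L / 2], which is at most
    [L / 2 |N|_F^2]. The rest comes from the rows that were not selected. *)
Lemma leak_tall n p (pn : (p.+1 <= n)%N) (X : 'M[R]_(n, p.+1)) (L : R) : 0 < L ->
  L <= s_min X ^+ 2 ->
  L / 2 <= leak (widen_ord (ltnW pn)) (L / (2 * (n + p.+1)%:R)) X.
Proof.
have n0 : (0 < n)%N by rewrite (leq_trans _ pn).
move=> L0 LX; set tau := L / (2 * _).
have np0 : 0 < (n + p.+1)%:R :> R by rewrite ltr0n addnS.
have tau0 : 0 < tau by rewrite divr_gt0// mulr_gt0.
set f := widen_ord _; set C := rowsub f X; set N := ridge C tau.
have froN : 1 <= sqfro N by exact: sqfro_ridge_ge1.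
have f0 : 0 < sqfro N by exact: sqfro_ridge_gt0.
have XN : L * sqfro N <= sqfro (X *m N).
  rewrite sqfro_mulmx -(sqfro_tr N) /sqfro mulr_sumr; apply: ler_sum => j _.
  rewrite qform_gram_col; apply: le_trans (s_min_col _ _ _ pn) => //.
  by rewrite ler_wpM2r ?sqnorm_ge0.
have CN : sqfro (C *m N) <= L / 2 * sqfro N.
  apply: (le_trans (sqfro_mul_ridge _ tau0)).
  apply: (@le_trans _ _ (L / 2)); last by rewrite ler_peMr// divr_ge0// ltW.
  rewrite /tau mulrAC ler_pdivrMr ?mulr_gt0//.
  have -> : L / 2 * (2 * (n + p.+1)%:R) = L * (n + p.+1)%:R by field.
  by rewrite ler_pM2l// ler_nat leq_addl.
rewrite /leak /row_leak -/C -/N -mulr_suml ler_pdivlMr//.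
have : sqfro (X *m N) = sqfro (C *m N) + \sum_(i | i \notin codom f) sqnorm (row i X *m N).
  rewrite /sqfro (bigID (fun i => i \in codom f)) /=; congr (_ + _); last first.
    by apply: eq_bigr => i _; rewrite row_mul.
  have finj : injective f by move=> a b /(congr1 val) /= /val_inj.
  rewrite (eq_bigl (fun i => i \in [set f j | j in 'I_p]%SET)); last first.
    by move=> i; apply/codomP/imsetP => [[j ->]|[j _ ->]]; exists j.
  rewrite big_imset /=; last by move=> a b _ _; exact: finj.
  apply: eq_big => // j _; rewrite !row_mul; congr (sqnorm (_ *m _)).
  by apply/rowP => i; rewrite !mxE.
lra.
Qed.

End LeakLowerBounds.

Section LeakMoments.
Context d (T : measurableType d) (R : realType) (P : probability T R).
Variables (n p : nat) (A : 'I_n -> 'M[R]_p) (Z : 'I_n * 'I_p -> {RV P >-> R}).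
Variables (Sigma : 'M[R]_p) (c_M : R).
Hypotheses (p0 : (0 < p)%N) (cM0 : 0 < c_M).
Hypotheses (iidZ : iid_normal Z) (AS : forall i, (A i)^T *m A i = Sigma).
Hypothesis Sigma_le : forall v, qform Sigma v <= c_M * sqnorm v.

Let X w := matrix_of_coords A (Z ^~ w).

Lemma measurable_matrix_of_coords d' (U : measurableType d') (Y : 'I_n * 'I_p -> U -> R) :
  (forall k, measurable_fun setT (Y k)) ->
  measurable_entries (fun u => matrix_of_coords A (Y ^~ u)).
Proof.
move=> mY i j; rewrite (_ : (fun u => _) = (fun u => \sum_l Y (i, l) u * A i l j)).
  by apply: measurable_sum => l; apply: measurable_funM.
by apply/funext => u; rewrite !mxE; apply: eq_bigr => l _; rewrite mxE.
Qed.

Variables (k : nat) (f : 'I_k -> 'I_n) (tau : R).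
Hypothesis tau0 : 0 < tau.

Let N z := ridge (rowsub f (matrix_of_coords A z)) tau.

Let mN d' (U : measurableType d') (Y : 'I_n * 'I_p -> U -> R) :
  (forall k, measurable_fun setT (Y k)) -> measurable_entries (fun u => N (Y ^~ u)).
Proof.
move=> mY; apply: measurable_ridge => // a b.
rewrite (_ : (fun u => _) = (fun u => matrix_of_coords A (Y ^~ u) (f a) b)).
  exact: measurable_matrix_of_coords.
by apply/funext => u; rewrite !mxE.
Qed.

Let froN0 z : 0 < sqfro (N z). Proof. exact: sqfro_ridge_gt0. Qed.

Lemma measurable_row_leak i : measurable_fun setT (fun w => row_leak f tau (X w) i).
Proof.
have mNZ := mN (fun k => @measurable_funPT _ _ _ _ (Z k)).
have mXZ := measurable_matrix_of_coords (fun k => @measurable_funPT _ _ _ _ (Z k)).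
apply: measurable_funM; last first.
  apply: (measurable_invr (measurable_sqfro mNZ)) => w; exact: froN0.
apply: measurable_sqnorm => j; apply: measurable_mulmx => // a b.
by rewrite (_ : (fun u => _) = (fun u => X u i b)) //; apply/funext => u; rewrite mxE.
Qed.

(** The ridge involves only the coordinates of the selected rows, so the
    coefficients of the coordinates of row i are independent of these, and
    [integral_sqnorm_combination_le] bounds the mean of [|X_i N|^2 / |N|_F^2] by
    [8 tr (N Sigma N) / |N|_F^2 <= 8 c_M]. *)
Lemma integral_row_leak_le i : i \notin codom f ->
  (\int[P]_w (row_leak f tau (X w) i)%:E <= (8 * c_M)%:E)%E.
Proof.
move=> fi.
(* The norm of N is divided out inside the coefficients; the power -1/2 keeps
   them Borel. *)
pose V (k : 'I_n * 'I_p) z := sqfro (N z) `^ (- 2^-1) *: (row k.2 (A i) *m N z).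
pose s := [seq (i, l) | l <- enum 'I_p].
have us : uniq s by rewrite map_inj_uniq ?enum_uniq// => a b [].
have c2 z : (sqfro (N z) `^ (- 2^-1)) ^+ 2 = (sqfro (N z))^-1.
  rewrite -powR_mulrn ?powR_ge0// -powRrM mulNr mulVf// powR_inv1//.
  exact: ltW.
have mV l j : borel_functional (fun z => V l z 0 j).
  move=> d' U Y mY.
  rewrite (_ : (fun u => _) = (fun u => sqfro (N (Y ^~ u)) `^ (- 2^-1) *
     (row l.2 (A i) *m N (Y ^~ u)) 0 j)); last by apply/funext => u; rewrite mxE.
  apply: measurable_funM.
    apply: (measurableT_comp (f := fun x : R => x `^ (- 2^-1))).
      exact: measurable_powR.
    exact/measurable_sqfro/mN.
  apply: (@measurable_mulmx _ _ _ _ _ _ (fun=> row l.2 (A i))) => //.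
  exact: mN.
have Vinv l l' z x : l \in s -> l' \in s -> V l (upd z l' x) = V l z.
  move=> _ /mapP[l0 _ ->]; rewrite /V; suff -> : N (upd z (i, l0) x) = N z by [].
  rewrite /N; congr (ridge _ _); apply/matrixP => a b; rewrite !mxE.
  apply: eq_bigr => c _; rewrite !mxE; congr (_ * _); rewrite /upd.
  by case: eqP => // -[fai _]; move: fi; rewrite -fai codom_f.
have := @integral_sqnorm_combination_le _ _ _ _ _ _ iidZ _ V mV s (fun=> 0) us Vinv.
have mz : borel_functional (fun _ : 'I_n * 'I_p -> R => 0 : R).
  by move=> d' U Y _; exact: measurable_cst.
move=> /(_ mz (fun=> lexx _) (fun _ _ _ _ => erefl)) H.
apply: (@le_trans _ _ (\int[P]_w (8 * c_M)%:E)%E); last first.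
  by rewrite integral_cst//= probability_setT mule1.
apply: le_trans (le_trans _ H) _.
  rewrite le_eqVlt; apply/orP; left; apply/eqP; apply: eq_integral => w _.
  congr (_%:E); rewrite addr0 /row_leak -/(N _) row_matrix_of_coords.
  rewrite big_map big_enum /= /V.
  transitivity (sqnorm (sqfro (N (Z ^~ w)) `^ (- 2^-1) *:
     ((\sum_l Z (i, l) w *: row l (A i)) *m N (Z ^~ w)))).
    by rewrite sqnormZ c2 mulrC.
  congr sqnorm; rewrite mulmx_suml scaler_sumr; apply: eq_bigr => l _.
  by rewrite -scalemxAl !scalerA mulrC.
apply: ge0_le_integralT => w; rewrite lee_fin addr0.
  by rewrite mulr_ge0// sumr_ge0// => *; exact: sqnorm_ge0.
rewrite ler_pM2l// big_map big_enum /=.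
under eq_bigr do rewrite /V sqnormZ c2.
rewrite -mulr_sumr mulrC ler_pdivrMr//.
have -> : \sum_l sqnorm (row l (A i) *m N (Z ^~ w)) = sqfro (A i *m N (Z ^~ w)).
  by apply: eq_bigr => l _; rewrite row_mul.
rewrite sqfro_mulmx AS -[in leRHS]sqfro_tr /sqfro mulr_sumr; apply: ler_sum => j _.
exact: Sigma_le.
Qed.

Lemma integral_leak_le :
  (\int[P]_w (leak f tau (X w))%:E <= (8 * c_M * #|[predC codom f]|%:R)%:E)%E.
Proof.
under eq_integral do rewrite /leak -big_filter -sumEFin.
rewrite ge0_integral_sum//; last 2 first.
- by move=> i; apply/measurable_EFinP; exact: measurable_row_leak.
- by move=> i w _; rewrite lee_fin row_leak_ge0.
rewrite big_filter.
apply: (@le_trans _ _ (\sum_(i | i \notin codom f) (8 * c_M)%:E)%E).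
  by apply: lee_sum => i fi; exact: integral_row_leak_le.
by rewrite sumEFin lee_fin sumr_const mulr_natr.
Qed.

Lemma measurable_leak : measurable_fun setT (fun w => leak f tau (X w)).
Proof.
rewrite (_ : (fun w => _) = (fun w => \sum_(i <- [seq i <- index_enum _ | i \notin codom f])
   row_leak f tau (X w) i)); last by apply/funext => w; rewrite /leak big_filter.
by apply: measurable_sum => i; exact: measurable_row_leak.
Qed.

Lemma prob_leak_ge rho : 0 < rho ->
  (P [set w | (rho <= leak f tau (X w))%R] <=
   (8 * c_M * #|[predC codom f]|%:R / rho)%:E)%E.
Proof.
move=> rho0; have mS := measurable_superlevel rho measurable_leak.
apply: (@le_trans _ _ (\int[P]_w ((rho^-1)%:E * (leak f tau (X w))%:E))%E).
  rewrite -[X in (P X <= _)%E]setIT -integral_indic//.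
  apply: ge0_le_integralT => w; first by rewrite lee_fin.
  rewrite -EFinM lee_fin indicE; case: (boolP (w \in _)) => [|_].
    by rewrite inE /= => h; rewrite mulrC ler_pdivlMr// mul1r.
  by rewrite mulr_ge0 ?leak_ge0// invr_ge0 ltW.
rewrite ge0_integralZl//=; last 3 first.
- by apply/measurable_EFinP; exact: measurable_leak.
- by move=> w _; rewrite lee_fin leak_ge0.
- by rewrite lee_fin invr_ge0 ltW.
rewrite [in leRHS]mulrC EFinM lee_wpmul2l ?integral_leak_le//.
by rewrite lee_fin invr_ge0 ltW.
Qed.

End LeakMoments.

(** * The critical regime *)

Section ConditionNumber.
Context {R : realType} {n p : nat}.
Implicit Type X : 'M[R]_(n, p).

Lemma condition_number_ge0 X : (0 <= condition_number X)%E.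
Proof.
by rewrite /condition_number mule_ge0 ?inve_ge0 ?lee_fin ?s_max_ge0 ?s_min_ge0.
Qed.

(** Holds also when [s_min X = 0], as the condition number is then +oo. *)
Lemma condition_number_ge X t L : 0 < t -> 0 < L -> t ^+ 2 * L <= s_max X ^+ 2 ->
  s_min X ^+ 2 < L -> (t%:E <= condition_number X)%E.
Proof.
move=> t0 L0 tM mL; rewrite /condition_number inver.
have M0 : 0 < s_max X.
  rewrite lt_neqAle s_max_ge0 andbT eq_sym -sqrf_eq0 gt_eqF//.
  by apply: lt_le_trans tM; rewrite mulr_gt0// exprn_gt0.
case: eqP => [_|/eqP m0]; first by rewrite gt0_muley ?lte_fin// leey.
have {}m0 : 0 < s_min X by rewrite lt_neqAle s_min_ge0 andbT eq_sym.
rewrite -EFinM lee_fin ler_pdivlMr// -ler_sqr ?nnegrE ?mulr_ge0 ?(ltW t0) ?(ltW m0) ?(ltW M0)//.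
by rewrite exprMn (le_trans _ tM)// ler_wpM2l ?sqr_ge0// ltW.
Qed.

Lemma condition_number_le X t L : 0 < t -> 0 < L -> s_max X ^+ 2 <= t ^+ 2 * L ->
  L <= s_min X ^+ 2 -> (condition_number X <= t%:E)%E.
Proof.
move=> t0 L0 Mt mL; have m0 : 0 < s_min X.
  rewrite lt_neqAle s_min_ge0 andbT eq_sym -sqrf_eq0 gt_eqF//.
  exact: lt_le_trans mL.
rewrite /condition_number inver gt_eqF// -EFinM lee_fin ler_pdivrMr//.
rewrite -ler_sqr ?nnegrE ?s_max_ge0 ?mulr_ge0 ?(ltW t0) ?(ltW m0)//.
by rewrite exprMn (le_trans Mt)// ler_wpM2l ?sqr_ge0.
Qed.

Lemma ler_poweR_condition_number X t r : 0 <= t -> 0 <= r ->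
  ((t%:E <= condition_number X)%E -> ((t `^ r)%:E <= condition_number X `^ r)%E) *
  ((condition_number X <= t%:E)%E -> (condition_number X `^ r <= (t `^ r)%:E)%E).
Proof.
move=> t0 r0; rewrite -poweR_EFin; split; apply: gt0_ler_poweR => //;
  by rewrite in_itv /= ?condition_number_ge0 ?lee_fin ?t0 leey.
Qed.

End ConditionNumber.

Section CriticalRegime.
Context d (T : measurableType d) (R : realType) (P : probability T R).
Variables (n p : nat) (A : 'I_n -> 'M[R]_p) (Z : 'I_n * 'I_p -> {RV P >-> R}).
Variables (Sigma : 'M[R]_p) (c_m c_M : R).
Hypotheses (n0 : (0 < n)%N) (p0 : (0 < p)%N) (cm0 : 0 < c_m) (cM0 : 0 < c_M).
Hypotheses (iidZ : iid_normal Z) (AS : forall i, (A i)^T *m A i = Sigma).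
Hypothesis symS : Sigma^T = Sigma.
Hypothesis Sigma_ge : forall v, c_m * sqnorm v <= qform Sigma v.
Hypothesis Sigma_le : forall v, qform Sigma v <= c_M * sqnorm v.

Let X w := matrix_of_coords A (Z ^~ w).

(** Markov's inequality for the leak past n - 1 of the rows if [n <= p], and
    past p - 1 of them otherwise. B is a measurable superset of the event
    [s_min X ^+ 2 >= L]. *)
Lemma s_min_tail (L : R) : 0 < L -> exists B : set T,
  [/\ measurable B,
      (P B <= (16 * c_M * ((p - n) + (n - p) + 2)%N%:R / L)%:E)%E &
      forall w, ~ B w -> s_min (X w) ^+ 2 < L].
Proof.
move=> L0; have np0 : 0 < (n + p)%:R :> R by rewrite ltr0n addn_gt0 n0.
pose tau := L / (2 * (n + p)%:R); have tau0 : 0 < tau by rewrite divr_gt0// mulr_gt0.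
have cardf k (f : 'I_k -> 'I_n) : injective f -> #|[predC codom f]| = (n - k)%N.
  move=> finj; have := cardC (mem (codom f)).
  have -> : #|mem (codom f)| = k by rewrite card_codom// card_ord.
  by rewrite card_ord; move: #|_| => x xn; rewrite -xn addKn.
have [np|pn] := leqP n p.
- case: n n0 A Z iidZ AS @X np0 @tau tau0 cardf np
    => // n' _ A' Z' iidZ' AS' X' np0 tau tau0 cardf np.
  pose rho := L / (p - n'.+1).+2%:R; have rho0 : 0 < rho by rewrite divr_gt0.
  exists [set w | rho <= leak (lift ord0) tau (X' w)]; split.
  + exact/measurable_superlevel/measurable_leak.
    apply: (le_trans (prob_leak_ge p0 iidZ' AS' Sigma_le _ tau0 rho0)).
    rewrite cardf; last exact: lift_inj.
    rewrite lee_fin subSnn mulr1 /rho invf_div mulrA ler_wpM2r ?invr_ge0 ?(ltW L0)//.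
    apply: ler_pM; rewrite ?ler_nat ?mulr_ge0 ?(ltW cM0)//; last by rewrite !addnS addn0 leq_addr.
    by rewrite ler_pM2r// ler_nat.
  + move=> w /= /negP; rewrite -ltNge; apply: contraTT; rewrite -!leNgt.
    exact: leak_wide.
- case: p p0 A Z Sigma iidZ AS Sigma_le @X np0 @tau tau0 cardf pn
    => // p' _ A' Z' S' iidZ' AS' S'_le X' np0 tau tau0 cardf pn.
  have rho0 : 0 < L / 2 by rewrite divr_gt0.
  exists [set w | L / 2 <= leak (widen_ord (ltnW (ltnW pn))) tau (X' w)]; split.
  + exact/measurable_superlevel/measurable_leak.
  + apply: (le_trans (prob_leak_ge _ iidZ' AS' S'_le _ tau0 rho0)) => //.
    rewrite cardf; last by move=> a b /(congr1 val) /= /val_inj.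
    rewrite lee_fin invf_div.
    have -> : 8 * c_M * (n - p')%:R * (2 / L) = 16 * c_M * (n - p')%:R / L.
      by field; rewrite gt_eqF.
    rewrite ler_wpM2r ?invr_ge0 ?(ltW L0)// ler_wpM2l ?mulr_ge0 ?(ltW cM0)// ler_nat.
    by lia.
  + move=> w /= /negP; rewrite -ltNge; apply: contraTT; rewrite -!leNgt.
    exact: (leak_tall (ltnW pn)).
Qed.

(** The factor 1/2 is the probability of the complement of two events of
    probability at most 1/4 each: s_min is not small, or the first row is
    short. *)
Lemma critical_moment_ge (L t r : R) : 0 < L -> 0 < t -> 0 <= r ->
  t ^+ 2 * L <= c_m / 64 * p%:R ->
  16 * c_M * ((p - n) + (n - p) + 2)%N%:R / L <= 1 / 4 ->
  ((t `^ r / 2)%:E <= \int[P]_w (condition_number (X w) `^ r))%E.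
Proof.
move=> L0 t0 r0 tL BL; have [B [mB PB BX]] := s_min_tail L0.
have pR : 0 < p%:R :> R by rewrite ltr0n.
(* With this rho the small-ball bound is (2 * sqrt (1/64)) ^ p = (1/4) ^ p. *)
pose rho := c_m / 64 * p%:R; have rho0 : 0 < rho by rewrite mulr_gt0// divr_gt0.
pose u : 'rV[R]_n := delta_mx 0 (Ordinal n0).
have u1 : sqnorm u = 1 by exact: sqnorm_delta.
pose S := [set w | sqnorm (u *m X w) <= rho].
have mS : measurable S.
  rewrite /S (_ : [set w | _] = [set w | - rho <= - sqnorm (u *m X w)]).
    apply: measurable_superlevel; apply: measurable_funN.
    exact: measurable_sqnorm_mul_coords.
  by apply/seteqP; split => w /=; rewrite lerN2.
have PS : (P S <= (1 / 4)%:E)%E.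
  apply: (le_trans (prob_sqnorm_mul_le p0 cm0 iidZ AS symS Sigma_ge rho0 _)).
    by rewrite u1.
  rewrite u1 mul1r lee_fin (_ : rho / _ = (1 / 8) ^+ 2); last first.
    by rewrite /rho; field; rewrite !gt_eqF.
  rewrite sqrtr_sqr ger0_norm; last by rewrite divr_ge0.
  have -> : 2 * (1 / 8) = 1 / 4 :> R by field.
  rewrite -[leRHS]expr1 ler_wiXn2l//.
  by lra.
pose D := ~` (B `|` S).
have mD : measurable D by apply: measurableC; exact: measurableU.
have PD : ((1 / 2)%:E <= P D)%E.
  rewrite /D probability_setC; last exact: measurableU.
  have PBS : (P (B `|` S) <= (1 / 4 + 1 / 4)%:E)%E.
    apply: (le_trans (measureU2 _ mB mS)).
    rewrite EFinD leeD//; apply: (le_trans PB); rewrite lee_fin//.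
  apply: (@le_trans _ _ (1 - (1 / 4 + 1 / 4)%:E)%E); last exact: leeB.
  by rewrite -EFinB lee_fin; lra.
apply: (@le_trans _ _ (\int[P]_w ((t `^ r)%:E * (\1_D w)%:E))%E); last first.
  apply: ge0_le_integralT => w.
    by rewrite -EFinM lee_fin mulr_ge0 ?powR_ge0.
  rewrite indicE; case: (boolP (w \in D)) => [|_]; last by rewrite mule0 poweR_ge0.
  rewrite inE => Dw; rewrite mule1; apply: (ler_poweR_condition_number _ (ltW t0) r0).1.
  have [Bw Sw] : ~ B w /\ ~ S w by split => h; apply: Dw; [left|right].
  apply: (condition_number_ge t0 L0 _ (BX _ Bw)).
  have := s_max_row (X w) p0 u; rewrite u1 mulr1; apply: le_trans.
  by apply: (le_trans tL); move/negP : Sw; rewrite -ltNge => /ltW.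
rewrite ge0_integralZl//=; last 2 first.
- by apply/measurable_EFinP; exact: measurable_indic.
- by rewrite lee_fin powR_ge0.
by rewrite integral_indic// setIT EFinM lee_wpmul2l ?lee_fin ?powR_ge0// -(mul1r 2^-1).
Qed.

End CriticalRegime.

(** * Nets of the unit sphere *)

Section Net.
Context {R : realType}.

(** Exponential counting: each k with [sum_i k_i <= n a] contributes at least 1
    to the sum of the [x ^ (sum_i k_i - n a)] when [x <= 1], and this sum over
    all k is the n-th power of a geometric series. With [x = a / (a + 1)] the
    base is at most [2 (a + 1) * 4 <= 16 a]. *)
Lemma card_bounded_weight (n a B : nat) : (0 < a)%N ->
  (#|[set k : {ffun 'I_n -> bool * 'I_B} | (\sum_i (k i).2 <= n * a)%N]| <=
   (16 * a) ^ n)%N.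
Proof.
move=> a0; set S := [set k | _]; have aR : 0 < a%:R :> R by rewrite ltr0n.
pose x : R := a%:R / a.+1%:R.
have x0 : 0 < x by rewrite divr_gt0.
have x1 : x <= 1 by rewrite ler_pdivrMr// mul1r ler_nat.
have xa0 : 0 < x ^+ a by rewrite exprn_gt0.
rewrite -(ler_nat R) -sum1_card natr_sum natrX.
apply: (@le_trans _ _ (\sum_(k in S) \prod_i (x ^+ (k i).2 / x ^+ a))).
  apply: ler_sum => k; rewrite inE => kS.
  have -> : \prod_i (x ^+ (k i).2 / x ^+ a) = x ^+ (\sum_i (k i).2)%N / x ^+ (n * a).
    by rewrite big_split /= -expr_sum prodr_const card_ord exprVn -exprM mulnC.
  by rewrite ler_pdivlMr ?exprn_gt0// mul1r ler_wiXn2l// ltW.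
apply: (@le_trans _ _ (\sum_(k : {ffun 'I_n -> bool * 'I_B}) \prod_i (x ^+ (k i).2 / x ^+ a))).
  rewrite [leRHS](bigID (mem S)) /= lerDl sumr_ge0// => k _.
  by rewrite prodr_ge0// => i _; rewrite divr_ge0// exprn_ge0// ltW.
rewrite -(bigA_distr_bigA (fun (i : 'I_n) (j : bool * 'I_B) => x ^+ j.2 / x ^+ a)) prodr_const card_ord.
rewrite lerXn2r// ?nnegrE; first by rewrite sumr_ge0// => i _; rewrite divr_ge0// exprn_ge0// ltW.
  by rewrite ler0n.
rewrite -mulr_suml.
have -> : \sum_(j : bool * 'I_B) x ^+ j.2 = 2 * \sum_(m < B) x ^+ m.
  rewrite -(pair_bigA _ (fun (b : bool) (m : 'I_B) => x ^+ m)) /=.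
  by rewrite big_bool /= mulr_natl mulr2n.
have geo : \sum_(m < B) x ^+ m <= a.+1%:R.
  have : (1 - x) * \sum_(m < B) x ^+ m <= 1.
    by rewrite -opprB mulNr -subrX1 opprB gerDl oppr_le0 exprn_ge0// ltW.
  have -> : 1 - x = a.+1%:R^-1 by rewrite /x -natr1; field; rewrite natr1 gt_eqF.
  by rewrite mulrC ler_pdivrMr// mul1r.
have xa : (x ^+ a)^-1 <= 4.
  have -> : (x ^+ a)^-1 = (1 + a%:R^-1) ^+ a.
    rewrite -exprVn; congr (_ ^+ _); rewrite /x -natr1; field.
    by rewrite !gt_eqF// addr_gt0.
  apply: (@le_trans _ _ (expR (a%:R^-1) ^+ a)).
    by rewrite lerXn2r// ?nnegrE ?expR_ge0 ?addr_ge0 ?invr_ge0// expR_ge1Dx.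
  rewrite -expRM_natl mulfV ?gt_eqF//.
  have -> : 1 = 2%:R * (1 / 2) :> R by field.
  rewrite expRM_natl; have := @expR_le1D2x R (1 / 2); have := expR_ge0 (1 / 2 : R).
  set e := expR _ => e0 /(_ _) eh; have : e <= 2 by apply: le_trans (eh _) _; lra.
  nra.
rewrite -mulrA natrM; apply: (@le_trans _ _ (2 * (a.+1%:R * 4))).
  by rewrite ler_pM2l// ler_pM// ?sumr_ge0 ?invr_ge0 ?(ltW xa0)// => m _; rewrite exprn_ge0// ltW.
rewrite -natr1; have : 1 <= a%:R :> R by rewrite ler1n.
lra.
Qed.

(** Round the coordinates towards zero on the grid of mesh
    [h = 1 / (a sqrt n)], which costs at most [n h^2 = a^-2]. A unit vector has
    l1-norm at most [sqrt n], so the rounded vectors have weight at most [n a] in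
    units of h; [card_bounded_weight] counts them. The net points need not be unit
    vectors. *)
Lemma exists_net (n a : nat) : (0 < n)%N -> (0 < a)%N ->
  exists N : seq 'rV[R]_n, (size N <= (16 * a) ^ n)%N /\
    forall u, sqnorm u = 1 -> exists2 v, v \in N & sqnorm (u - v) <= a%:R ^- 2.
Proof.
move=> n0 a0; have aR : 0 < a%:R :> R by rewrite ltr0n.
have nR : 0 < n%:R :> R by rewrite ltr0n.
pose h : R := (a%:R * Num.sqrt n%:R)^-1.
have h0 : 0 < h by rewrite invr_gt0 mulr_gt0// sqrtr_gt0.
have h2 : h ^+ 2 = (a%:R ^+ 2 * n%:R)^-1 by rewrite exprVn exprMn sqr_sqrtr// ltW.
pose B := (n * a).+1.
pose g (k : {ffun 'I_n -> bool * 'I_B}) : 'rV[R]_n :=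
  \row_i (h * ((-1) ^+ (k i).1 * (k i).2%:R)).
exists [seq g k | k <- enum [set k : {ffun 'I_n -> bool * 'I_B} | (\sum_i (k i).2 <= n * a)%N]].
split; first by rewrite size_map -cardE card_bounded_weight.
move=> u u1; pose x i := `|u 0 i| / h; pose m i := Num.truncn (x i).
have x0 i : 0 <= x i by rewrite divr_ge0// ltW.
have mle i : (m i)%:R <= x i by rewrite truncn_le.
have summ : (\sum_i m i <= n * a)%N.
  rewrite -(ler_nat R) natr_sum.
  apply: (@le_trans _ _ (\sum_i ((x i ^+ 2 / a%:R + a%:R) / 2))).
    apply: ler_sum => i _; apply: (le_trans (mle i)).
    have := sqr_ge0 (x i - a%:R); rewrite ler_pdivlMr// => h3.
    rewrite -(ler_pM2r aR) mulrDl mulfVK ?gt_eqF//; nra.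
  rewrite -mulr_suml big_split /= -mulr_suml sumr_const card_ord.
  have -> : \sum_i x i ^+ 2 = a%:R ^+ 2 * n%:R.
    rewrite -[RHS]invrK -h2 -[RHS]mul1r -u1 /sqnorm mulr_suml.
    by apply: eq_bigr => i _; rewrite expr_div_n real_normK ?num_real.
  rewrite natrM -[a%:R *+ n]mulr_natr le_eqVlt; apply/orP; left; apply/eqP.
  by field; rewrite gt_eqF.
have mB i : (m i < B)%N.
  by rewrite ltnS (leq_trans _ summ)// (bigD1 i)//= leq_addr.
pose k := [ffun i => (u 0 i < 0, Ordinal (mB i))].
exists (g k).
  apply: map_f; rewrite mem_enum inE; apply: leq_trans summ.
  by apply: leq_sum => i _; rewrite ffunE.
have gk i : (u 0 i - g k 0 i) ^+ 2 <= h ^+ 2.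
  have uE : u 0 i = h * ((-1) ^+ (u 0 i < 0)%R * x i).
    rewrite /x mulrCA [h * (_ / _)]mulrC divfK ?gt_eqF//.
    by rewrite -realEsign ?num_real.
  rewrite mxE ffunE /= {1}uE -mulrBr -mulrBr !exprMn sqrr_sign mul1r ler_piMr ?sqr_ge0//.
  have /andP[t1 t2] := truncn_itv (x0 i).
  rewrite expr_le1// ?subr_ge0// lerBlDl natr1; exact: ltW.
apply: (@le_trans _ _ (\sum_(i < n) h ^+ 2)).
  by apply: ler_sum => i _; have := gk i; rewrite !mxE.
rewrite sumr_const card_ord h2 -[X in X <= _]mulr_natl le_eqVlt; apply/orP; left; apply/eqP.
by field; rewrite !gt_eqF.
Qed.

End Net.

(** * Tail of the condition number of a wide matrix *)

Section FiniteUnion.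
Context d (T : measurableType d) (R : realType) (P : probability T R).

Lemma prob_exists_le (V : eqType) (s : seq V) (F : V -> set T) (b : R) :
  (forall v, v \in s -> measurable (F v)) ->
  (forall v, v \in s -> (P (F v) <= b%:E)%E) ->
  measurable [set w | exists2 v, v \in s & F v w] /\
  (P [set w | exists2 v, v \in s & F v w] <= ((size s)%:R * b)%:E)%E.
Proof.
elim: s => [|v s IH] mF PF.
  have -> : [set w | exists2 v, v \in [::] & F v w] = set0.
    by apply/seteqP; split => w // -[].
  by split => //; rewrite measure0 mul0r.
have sub u : u \in s -> u \in v :: s by rewrite inE => ->; rewrite orbT.
have [ms Ps] := IH (fun u us => mF u (sub u us)) (fun u us => PF u (sub u us)).
have -> : [set w | exists2 u, u \in v :: s & F u w] =
    F v `|` [set w | exists2 u, u \in s & F u w].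
  apply/seteqP; split => w /=.
    by move=> [u]; rewrite inE => /orP[/eqP ->|us] Fu; [left|right; exists u].
  by move=> [Fv|[u us Fu]]; [exists v; rewrite ?mem_head|exists u => //; rewrite inE us orbT].
have mv := mF v (mem_head _ _); split; first exact: measurableU.
apply: (le_trans (measureU2 _ mv ms)).
by rewrite /= -natr1 mulrDl mul1r addrC EFinD leeD// PF ?mem_head.
Qed.

End FiniteUnion.

Section NetArguments.
Context {R : realType}.

(** Reduces a homogeneous inequality between [sqnorm u] and [sqnorm (u *m X)]
    to unit vectors. *)
Lemma unit_vectors n p (X : 'M[R]_(n, p)) (Q : R -> R -> Prop) :
  (forall a x y, Q x y -> Q (a ^+ 2 * x) (a ^+ 2 * y)) -> Q 0 0 ->
  (forall u, sqnorm u = 1 -> Q (sqnorm u) (sqnorm (u *m X))) ->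
  forall u, Q (sqnorm u) (sqnorm (u *m X)).
Proof.
move=> QZ Q0 Qu u; have [->|u0] := eqVneq u 0.
  have sq0 k : sqnorm (0 : 'rV[R]_k) = 0 by apply/eqP; rewrite sqnorm_eq0.
  by rewrite mul0mx !sq0.
have su : 0 < sqnorm u by rewrite lt_neqAle sqnorm_ge0 andbT eq_sym sqnorm_eq0.
pose a := Num.sqrt (sqnorm u); have a0 : 0 < a by rewrite sqrtr_gt0.
have v1 : sqnorm (a^-1 *: u) = 1.
  by rewrite sqnormZ exprVn sqr_sqrtr ?sqnorm_ge0// mulVf// gt_eqF.
have := QZ a _ _ (Qu _ v1).
by rewrite -scalemxAl !sqnormZ exprVn !mulVKf // ?expf_neq0 ?gt_eqF.
Qed.

(** With [s = s_max X ^+ 2], a net point v near u gives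
    [|uX|^2 <= 2 rho + 2 s / 4]; taking the best bound over u,
    [s <= 2 rho + s / 2]. *)
Lemma s_max_net n p (X : 'M[R]_(n, p)) (N : seq 'rV[R]_n) rho :
  (0 < n)%N -> (0 < p)%N -> 0 <= rho ->
  (forall u, sqnorm u = 1 -> exists2 v, v \in N &
     sqnorm (u - v) <= 1 / 4 /\ sqnorm (v *m X) <= rho) ->
  s_max X ^+ 2 <= 4 * rho.
Proof.
move=> n0 p0 rho0 HN; set s := s_max X ^+ 2.
have s0 : 0 <= s by exact: sqr_ge0.
suff : s <= 2 * rho + s / 2 by lra.
apply: s_max_le => //; first by have := s0; lra.
apply: (@unit_vectors _ _ _ (fun x y => y <= (2 * rho + s / 2) * x)).
- by move=> a x y xy; rewrite mulrCA ler_wpM2l ?sqr_ge0.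
- by rewrite mulr0.
move=> u u1; rewrite u1 mulr1; have [v vN [uv vX]] := HN u u1.
have -> : u *m X = v *m X + (u - v) *m X by rewrite mulmxBl addrC subrK.
apply: (le_trans (sqnormD_le _ _)).
have := s_max_row X p0 (u - v); rewrite -/s.
have := ler_wpM2l s0 uv; lra.
Qed.

Lemma s_min_net n p (X : 'M[R]_(n, p)) (N : seq 'rV[R]_n) rho e :
  (0 < n)%N -> (n <= p)%N ->
  (forall u, sqnorm u = 1 -> exists2 v, v \in N &
     sqnorm (u - v) <= e /\ rho <= sqnorm (v *m X)) ->
  s_max X ^+ 2 * e <= rho / 4 ->
  rho / 4 <= s_min X ^+ 2.
Proof.
move=> n0 np HN se; have p0 : (0 < p)%N by exact: leq_trans np.
set s := s_max X ^+ 2 in se *; have s0 : 0 <= s by exact: sqr_ge0.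
apply: le_s_min => //.
apply: (@unit_vectors _ _ _ (fun x y => rho / 4 * x <= y)).
- by move=> a x y xy; rewrite mulrCA ler_wpM2l ?sqr_ge0.
- by rewrite mulr0.
move=> u u1; rewrite u1 mulr1; have [v vN [uv vX]] := HN u u1.
have : sqnorm (v *m X) <= 2 * sqnorm (u *m X) + 2 * sqnorm ((u - v) *m X).
  have -> : v *m X = u *m X + - ((u - v) *m X) by rewrite mulmxBl opprB addrC subrK.
  by apply: (le_trans (sqnormD_le _ _)); rewrite sqnormN.
have := s_max_row X p0 (u - v); rewrite -/s.
have := ler_wpM2l s0 uv; lra.
Qed.

Lemma sqnorm_near_unit m (u v : 'rV[R]_m) : sqnorm u = 1 -> sqnorm (u - v) <= 1 / 4 ->
  1 / 4 <= sqnorm v <= 4.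
Proof.
move=> u1 uv; apply/andP; split.
  have := sqnormD_le v (u - v); rewrite addrC subrK u1; lra.
have e : sqnorm (v - u) = sqnorm (u - v) by rewrite -opprB sqnormN.
have := sqnormD_le u (v - u); rewrite addrC subrK e u1; lra.
Qed.

End NetArguments.

Section WideRegime.
Context d (T : measurableType d) (R : realType) (P : probability T R).
Variables (n p : nat) (A : 'I_n -> 'M[R]_p) (Z : 'I_n * 'I_p -> {RV P >-> R}).
Variables (Sigma : 'M[R]_p) (c_m c_M : R).
Hypotheses (n0 : (0 < n)%N) (np : (n <= p)%N) (cm0 : 0 < c_m) (cM0 : 0 < c_M).
Hypotheses (iidZ : iid_normal Z) (AS : forall i, (A i)^T *m A i = Sigma).
Hypothesis symS : Sigma^T = Sigma.
Hypothesis Sigma_ge : forall v, c_m * sqnorm v <= qform Sigma v.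
Hypothesis Sigma_le : forall v, qform Sigma v <= c_M * sqnorm v.

Let X w := matrix_of_coords A (Z ^~ w).
Let p0 : (0 < p)%N. Proof. exact: leq_trans np. Qed.

(** 32 = 16 * 2 is the base of the cardinality of the nets. The two terms come
    from the upper and the lower tail bound at net points, whose squared norms lie
    between 1/4 and 4. *)
Definition wide_const : R := 32 * (4 * (32 * c_M) + 4 / Num.sqrt c_m).

Lemma wide_const_gt0 : 0 < wide_const.
Proof.
have h1 : 0 < 4 * (32 * c_M) by rewrite !mulr_gt0.
have h2 : 0 < 4 / Num.sqrt c_m by rewrite divr_gt0// sqrtr_gt0.
by rewrite mulr_gt0// addr_gt0.
Qed.

(** The number q is chosen so large that the [O(a ^ q) ^ n] points of the fine
    net are outweighed by the small-ball probability, which is of order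
    [(a / a ^ q) ^ p] at each of them. *)
Lemma condition_number_tail (q a : nat) : (0 < a)%N -> (2 * p <= q * (p - n))%N ->
  exists E : set T, [/\ measurable E,
    (P E <= (2 * (wide_const / a%:R) ^+ p)%:E)%E &
    forall w, ~ E w -> (condition_number (X w) <= (2 * a%:R ^+ q)%:E)%E].
Proof.
move=> a0 qpn; have aR : 0 < a%:R :> R by rewrite ltr0n.
have a1 : 1 <= a%:R :> R by rewrite ler1n.
have pR : 0 < p%:R :> R by rewrite ltr0n.
have mX u := measurable_sqnorm_mul_coords A Z u.
(* The exponent of a in (a^q)^n (a / a^q)^p is then at most -p. *)
have expo : (q * n + 2 * p <= q * p)%N.
  by move: qpn; rewrite mulnBr leq_subRL// leq_mul2l np orbT.
have aq0 : 0 < a%:R ^+ q :> R by rewrite exprn_gt0.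
have aq1 : 1 <= a%:R ^+ q :> R by rewrite exprn_ege1.
have sc : 0 < Num.sqrt c_m by rewrite sqrtr_gt0.
have [N1 [sN1 HN1]] := @exists_net R n 2 n0 isT.
have [N2 [sN2 HN2]] : exists N : seq 'rV[R]_n, (size N <= (16 * (2 * a ^ q)) ^ n)%N /\
    forall u, sqnorm u = 1 -> exists2 v, v \in N & sqnorm (u - v) <= (2 * a ^ q)%N%:R ^- 2.
  by apply: exists_net => //; rewrite muln_gt0 expn_gt0 a0.
pose good (v : 'rV[R]_n) := 1 / 4 <= sqnorm v <= 4.
(* Off the two exceptional events, s_max^2 <= 4 rho1 = a^2 p and
   s_min^2 >= rho2 / 4, whose ratio is (2 a^q)^2. *)
pose rho1 : R := a%:R ^+ 2 * p%:R / 4.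
pose rho2 : R := a%:R ^+ 2 * p%:R / (a%:R ^+ q) ^+ 2.
have rho10 : 0 < rho1 by rewrite divr_gt0// mulr_gt0// exprn_gt0.
have rho20 : 0 < rho2 by rewrite divr_gt0 ?mulr_gt0// !exprn_gt0.
have good0 v : good v -> 0 < sqnorm v by move=> /andP[h _]; lra.
pose F1 v := [set w | rho1 <= sqnorm (v *m X w)].
pose F2 v := [set w | sqnorm (v *m X w) <= rho2].
have mF1 v : measurable (F1 v) by exact: measurable_superlevel.
have mF2 v : measurable (F2 v).
  rewrite /F2 (_ : [set w | _] = [set w | - rho2 <= - sqnorm (v *m X w)]).
    by apply: measurable_superlevel; apply: measurable_funN.
  by apply/seteqP; split => w /=; rewrite lerN2.
have PF1 v : good v -> (P (F1 v) <= ((4 * (32 * c_M) / a%:R) ^+ p)%:E)%E.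
  move=> gv; have v0 := good0 v gv.
  apply: (le_trans (prob_sqnorm_mul_ge p0 cM0 iidZ AS symS Sigma_le rho10 v0)).
  rewrite lee_fin.
  have -> : 8 * (sqnorm v * c_M) * p%:R / rho1 = 32 * (sqnorm v * c_M) / a%:R ^+ 2.
    by rewrite /rho1; field; rewrite !gt_eqF.
  rewrite lerXn2r// ?nnegrE.
  - by rewrite divr_ge0 ?exprn_ge0 ?mulr_ge0 ?sqnorm_ge0 ?(ltW cM0).
  - by rewrite divr_ge0 ?mulr_ge0 ?(ltW cM0).
  apply: (@le_trans _ _ (4 * (32 * c_M) / a%:R ^+ 2)).
    rewrite ler_wpM2r ?invr_ge0 ?sqr_ge0//.
    by move/andP : gv => [_ v4]; have := ler_wpM2r (ltW cM0) v4; lra.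
  rewrite ler_wpM2l ?mulr_ge0 ?(ltW cM0)// lef_pV2 ?posrE ?exprn_gt0//.
  by rewrite expr2 ler_peMr// ltW.
have PF2 v : good v -> (P (F2 v) <= ((4 * (a%:R / a%:R ^+ q) / Num.sqrt c_m) ^+ p)%:E)%E.
  move=> gv; have v0 := good0 v gv.
  apply: (le_trans (prob_sqnorm_mul_le p0 cm0 iidZ AS symS Sigma_ge rho20 v0)).
  set y := a%:R / a%:R ^+ q; have y0 : 0 < y by rewrite divr_gt0.
  rewrite lee_fin.
  have -> : rho2 / (p%:R * (sqnorm v * c_m)) = y ^+ 2 / (sqnorm v * c_m).
    by rewrite /rho2 /y; field; rewrite !gt_eqF.
  rewrite lerXn2r// ?nnegrE ?mulr_ge0 ?sqrtr_ge0 ?invr_ge0 ?(ltW y0)//.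
  rewrite -(ler_pM2l (_ : 0 < 2^-1)) ?invr_gt0// mulKf//.
  rewrite -ler_sqr ?nnegrE ?sqrtr_ge0//; last by rewrite !mulr_ge0 ?invr_ge0 ?(ltW sc) ?(ltW y0).
  rewrite sqr_sqrtr ?divr_ge0 ?sqr_ge0 ?mulr_ge0 ?sqnorm_ge0 ?(ltW cm0)//.
  have -> : (2^-1 * (4 * y / Num.sqrt c_m)) ^+ 2 = y ^+ 2 * (4 / c_m).
    by rewrite -[in RHS](sqr_sqrtr (ltW cm0)); field; rewrite gt_eqF.
  rewrite ler_pM2l ?exprn_gt0// -[leLHS]div1r ler_pdivrMr ?mulr_gt0//.
  rewrite (_ : 4 / c_m * (sqnorm v * c_m) = 4 * sqnorm v); last by field; rewrite gt_eqF.
  by move/andP : gv => [v4 _]; lra.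
have [mE1 PE1] := prob_exists_le (s := [seq v <- N1 | good v]) (fun v _ => mF1 v)
  (fun v vN => PF1 v (proj1 (andP (eq_ind _ is_true vN _ (mem_filter _ _ _))))).
have [mE2 PE2] := prob_exists_le (s := [seq v <- N2 | good v]) (fun v _ => mF2 v)
  (fun v vN => PF2 v (proj1 (andP (eq_ind _ is_true vN _ (mem_filter _ _ _))))).
exists ([set w | exists2 v, v \in [seq v <- N1 | good v] & F1 v w] `|`
        [set w | exists2 v, v \in [seq v <- N2 | good v] & F2 v w]); split.
- exact: measurableU.
- apply: (le_trans (measureU2 _ mE1 mE2)).
  have C0 := wide_const_gt0.
  rewrite [2 * _]mulr_natl mulr2n EFinD leeD//.
  + apply: (le_trans PE1); rewrite lee_fin.
    apply: (@le_trans _ _ (32 ^+ p * (4 * (32 * c_M) / a%:R) ^+ p)).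
      rewrite ler_wpM2r ?exprn_ge0 ?divr_ge0 ?mulr_ge0 ?(ltW cM0)//.
      rewrite -natrX ler_nat size_filter (leq_trans (count_size _ _))//.
      by rewrite (leq_trans sN1)// leq_pexp2l.
    have y0 : 0 <= 4 * (32 * c_M) by rewrite !mulr_ge0// ltW.
    have s0 : 0 < 4 / Num.sqrt c_m by rewrite divr_gt0.
    rewrite -exprMn lerXn2r// ?nnegrE ?divr_ge0 ?(ltW C0)//; first by rewrite mulr_ge0// divr_ge0.
    rewrite [32 * (_ / _)]mulrA ler_pM2r ?invr_gt0// /wide_const; lra.
  + apply: (le_trans PE2); rewrite lee_fin.
    apply: (@le_trans _ _
      ((32 ^+ p * (a%:R ^+ q) ^+ n) * (4 * (a%:R / a%:R ^+ q) / Num.sqrt c_m) ^+ p)).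
      rewrite ler_wpM2r ?exprn_ge0 ?mulr_ge0 ?invr_ge0 ?(ltW sc) ?(ltW aq0)//.
      rewrite -!natrX -natrM ler_nat size_filter (leq_trans (count_size _ _))//.
      by rewrite (leq_trans sN2)// mulnA expnMn leq_mul2r leq_pexp2l ?orbT.
    apply: (@le_trans _ _ ((32 * (4 / Num.sqrt c_m) / a%:R) ^+ p)); last first.
      have s0 : 0 < 4 / Num.sqrt c_m by rewrite divr_gt0.
      have z0 : 0 <= 32 * (4 / Num.sqrt c_m) / a%:R by rewrite divr_ge0// mulr_ge0// ltW.
      have z1 : 0 <= wide_const / a%:R by rewrite divr_ge0// ltW.
      rewrite lerXn2r// ?nnegrE//.
      by rewrite ler_pM2r ?invr_gt0// /wide_const ler_pM2l// lerDr !mulr_ge0// ltW.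
    have -> : 32 ^+ p * (a%:R ^+ q) ^+ n * (4 * (a%:R / a%:R ^+ q) / Num.sqrt c_m) ^+ p =
       (32 * (4 / Num.sqrt c_m)) ^+ p * ((a%:R ^+ q) ^+ n * (a%:R / a%:R ^+ q) ^+ p).
      have -> : 4 * (a%:R / a%:R ^+ q) / Num.sqrt c_m =
        4 / Num.sqrt c_m * (a%:R / a%:R ^+ q) by rewrite mulrAC.
      rewrite !(exprMn _ (4 / _)) [(32 * _) ^+ p]exprMn.
      by rewrite -!mulrA; congr (_ * _); rewrite mulrCA.
    rewrite [leRHS]exprMn ler_pM2l ?exprn_gt0 ?mulr_gt0 ?invr_gt0//.
    rewrite expr_div_n mulrA ler_pdivrMr ?exprn_gt0// exprVn mulrC ler_pdivlMl ?exprn_gt0//.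
    by rewrite -!exprM -!exprD ler_weXn2l// addnA addnn -mul2n addnC.
- move=> w /not_orP[nE1 nE2].
  have sM : s_max (X w) ^+ 2 <= 4 * rho1.
    apply: (@s_max_net _ _ _ (X w) N1) => //; first exact: ltW.
    move=> u u1; have [v vN uv] := HN1 u u1; exists v => //.
    have uv4 : sqnorm (u - v) <= 1 / 4 by apply: (le_trans uv); lra.
    split => //; rewrite leNgt; apply/negP => h; apply: nE1.
    exists v; last exact: ltW.
    by rewrite mem_filter vN andbT; exact: (sqnorm_near_unit u1 uv4).
  have sm : rho2 / 4 <= s_min (X w) ^+ 2.
    have e4 : (2 * a ^ q)%N%:R ^- 2 = 1 / 4 / (a%:R ^+ q) ^+ 2 :> R.
      by rewrite natrM natrX exprMn; field; rewrite gt_eqF.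
    apply: (@s_min_net _ _ _ (X w) N2 _ (1 / 4 / (a%:R ^+ q) ^+ 2)) => //.
      move=> u u1; have [v vN uv] := HN2 u u1; exists v => //.
      rewrite -e4; split => //; rewrite leNgt; apply/negP => h; apply: nE2.
      exists v; last exact: ltW.
      rewrite mem_filter vN andbT; apply: (sqnorm_near_unit u1).
      apply: (le_trans uv); rewrite e4 ler_pdivrMr ?exprn_gt0// ler_peMr//.
      by rewrite exprn_ege1.
    apply: (@le_trans _ _ (4 * rho1 * (1 / 4 / (a%:R ^+ q) ^+ 2))).
      by rewrite ler_wpM2r// !divr_ge0// sqr_ge0.
    rewrite le_eqVlt; apply/orP; left; apply/eqP; rewrite /rho1 /rho2.
    by field; rewrite gt_eqF.
  apply: (@condition_number_le _ _ _ _ _ (rho2 / 4)) => //.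
  - by rewrite mulr_gt0.
  - by rewrite divr_gt0.
  - apply: (le_trans sM); rewrite le_eqVlt; apply/orP; left; apply/eqP.
    by rewrite /rho1 /rho2; field; rewrite gt_eqF.
Qed.

End WideRegime.

(** * Moments from dyadic tails *)

Section DyadicMoment.
Context d (T : measurableType d) (R : realType) (P : probability T R).

(** F is bounded by b plus the series of the [b x^(m+1) 1_(E_m)]: if m + 1 is the
    first index whose event fails at w, the m-th term bounds [F w], and where no
    event fails the series diverges. The m-th term has integral at most
    [2 b x / 2^m]. *)
Lemma integral_le_dyadic (F : T -> \bar R) (E : nat -> set T) (b x : R) :
  0 < b -> 1 <= x -> (forall w, 0 <= F w)%E ->
  (forall m, measurable (E m)) ->
  (forall m, P (E m) <= (2 / (2 * x) ^+ m)%:E)%E ->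
  (forall m w, ~ E m w -> F w <= (b * x ^+ m)%:E)%E ->
  (\int[P]_w F w <= (b * (1 + 4 * x))%:E)%E.
Proof.
move=> b0 x1 F0 mE PE FE.
have x0 : 0 < x by apply: lt_le_trans x1.
pose t m w : \bar R := ((b * x ^+ m.+1)%:E * (\1_(E m) w)%:E)%E.
have t0 m w : (0 <= t m w)%E.
  by rewrite /t -EFinM lee_fin !mulr_ge0 ?exprn_ge0 ?(ltW b0) ?(ltW x0).
have mt m : measurable_fun setT (t m).
  by apply: emeasurable_funM => //; apply/measurable_EFinP; exact: measurable_indic.
pose g w := (b%:E + \sum_(0 <= m <oo) t m w)%E.
have Fg w : (F w <= g w)%E.
  have [allE|/existsNP[m0 nE0]] := pselect (forall m, E m w).
    suff -> : g w = +oo%E by rewrite leey.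
    apply/eqyP => K K0; pose N := (Num.truncn (K / b)).+1.
    apply: (@le_trans _ _ (\sum_(0 <= m < N) t m w)%E); last first.
      apply: (le_trans (nneseries_lim_ge (P := xpredT) N _)); first by move=> *; exact: t0.
      by rewrite leeDr// lee_fin ltW.
    apply: (@le_trans _ _ (\sum_(0 <= m < N) b%:E)%E).
      rewrite sumEFin lee_fin sumr_const_nat subn0 -mulr_natl -ler_pdivrMr//.
      by rewrite /N ltW// truncnS_gt.
    apply: lee_sum => m _; rewrite /t indicE mem_set// mule1 lee_fin ler_peMr ?(ltW b0)//.
    by rewrite exprn_ege1.
  have exE : exists m, `[< ~ E m w >] by exists m0; apply/asboolP.
  case: (ex_minnP exE) => -[|m] /asboolP nE mmin.
    apply: (le_trans (FE _ _ nE)); rewrite expr0 mulr1 /g leeDl//.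
    by apply: nneseries_ge0 => *; exact: t0.
  have Em : E m w.
    by apply: contrapT => h; have := mmin m; rewrite ltnn => H; have := H (introT (asboolP _) h).
  apply: (le_trans (FE _ _ nE)).
  apply: (@le_trans _ _ (t m w)); first by rewrite /t indicE mem_set// mule1.
  apply: (@le_trans _ _ (\sum_(0 <= i < m.+1) t i w)%E).
    by rewrite big_nat_recr//= leeDr// sume_ge0.
  apply: (le_trans (nneseries_lim_ge (P := xpredT) m.+1 _)); first by move=> *; exact: t0.
  by rewrite leeDr// lee_fin ltW.
have Hle : (\int[P]_w F w <= \int[P]_w g w)%E by exact: ge0_le_integralT.
apply: (le_trans Hle); rewrite /g.
rewrite ge0_integralD//=; last 3 first.
- by move=> w _; rewrite lee_fin ltW.
- by move=> w _; apply: nneseries_ge0 => *; exact: t0.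
- by apply: ge0_emeasurable_sum => *; [exact: t0|exact: mt].
rewrite integral_cst//= probability_setT mule1 integral_nneseries//.
rewrite mulrDr mulr1 EFinD leeD2l//.
apply: lime_le; first by apply: is_cvg_nneseries => m _ _; apply: integral_ge0.
apply: nearW => N.
apply: (@le_trans _ _ (\sum_(0 <= m < N) (2 * b * x * (1 / 2) ^+ m)%:E)%E).
  apply: lee_sum => m _; rewrite /t ge0_integralZl//; last 2 first.
  - by apply/measurable_EFinP; exact: measurable_indic.
  - by rewrite lee_fin mulr_ge0 ?exprn_ge0 ?(ltW b0) ?(ltW x0).
  rewrite integral_indic// setIT.
  apply: (@le_trans _ _ ((b * x ^+ m.+1)%:E * (2 / (2 * x) ^+ m)%:E)%E).
    apply: lee_wpmul2l; last exact: PE.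
    by rewrite lee_fin mulr_ge0 ?exprn_ge0 ?(ltW b0) ?(ltW x0).
  rewrite -EFinM lee_fin le_eqVlt; apply/orP; left; apply/eqP.
  by rewrite exprS expr_div_n expr1n exprMn; field; rewrite !expf_neq0 ?gt_eqF.
rewrite sumEFin lee_fin -mulr_sumr.
have : \sum_(0 <= m < N) (1 / 2 : R) ^+ m <= 2.
  rewrite big_mkord; have := @subrX1 R (1 / 2) N.
  have : 0 <= (1 / 2 : R) ^+ N by rewrite exprn_ge0.
  move: (\sum_(i < N) _) => S; lra.
have bx : 0 <= 2 * b * x by rewrite !mulr_ge0 ?(ltW b0) ?(ltW x0).
move=> /(ler_wpM2l bx); lra.
Qed.

End DyadicMoment.

Section WideMoment.
Context d (T : measurableType d) (R : realType) (P : probability T R).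
Variables (n p : nat) (A : 'I_n -> 'M[R]_p) (Z : 'I_n * 'I_p -> {RV P >-> R}).
Variables (Sigma : 'M[R]_p) (c_m c_M : R).
Hypotheses (n0 : (0 < n)%N) (np : (n <= p)%N) (cm0 : 0 < c_m) (cM0 : 0 < c_M).
Hypotheses (iidZ : iid_normal Z) (AS : forall i, (A i)^T *m A i = Sigma).
Hypothesis symS : Sigma^T = Sigma.
Hypothesis Sigma_ge : forall v, c_m * sqnorm v <= qform Sigma v.
Hypothesis Sigma_le : forall v, qform Sigma v <= c_M * sqnorm v.

Let X w := matrix_of_coords A (Z ^~ w).

(** Apply [condition_number_tail] at the scales [a = a0 2^m]. The hypothesis
    [s < p] makes the decay [2^(- m p)] of the probabilities win over the growth
    [2^(m s)] of the moments. *)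
Lemma wide_moment_le (q s a0 : nat) (r : R) : 0 <= r -> q%:R * r <= s%:R ->
  (s < p)%N -> (2 * p <= q * (p - n))%N -> (0 < a0)%N ->
  wide_const c_m c_M <= a0%:R ->
  (\int[P]_w (condition_number (X w) `^ r) <=
   (2 `^ r * a0%:R ^+ s * (1 + 4 * 2 ^+ s))%:E)%E.
Proof.
move=> r0 qrs sp qpn a00 Ca0.
have a0R : 0 < a0%:R :> R by rewrite ltr0n.
have /choice[E EP] : forall m, exists E : set T, [/\ measurable E,
    (P E <= (2 * (wide_const c_m c_M / (a0 * 2 ^ m)%N%:R) ^+ p)%:E)%E &
    forall w, ~ E w -> (condition_number (X w) <= (2 * (a0 * 2 ^ m)%N%:R ^+ q)%:E)%E].
  move=> m; apply: (condition_number_tail n0 np cm0 cM0 iidZ AS symS Sigma_ge Sigma_le _ qpn).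
  by rewrite muln_gt0 a00 expn_gt0.
apply: (@integral_le_dyadic _ _ _ _ _ E).
- by rewrite mulr_gt0 ?exprn_gt0// powR_gt0.
- by rewrite exprn_ege1// ler1n.
- by move=> w; exact: poweR_ge0.
- by move=> m; have [] := EP m.
- move=> m; have [_ PE _] := EP m; apply: (le_trans PE); rewrite lee_fin.
  rewrite ler_pM2l// natrM natrX.
  have h : wide_const c_m c_M / (a0%:R * 2 ^+ m) <= (2 ^+ m)^-1.
    rewrite invfM mulrA ler_piMl ?invr_ge0 ?exprn_ge0//.
    by rewrite ler_pdivrMr// mul1r.
  have C0 : 0 <= wide_const c_m c_M by apply/ltW/wide_const_gt0.
  apply: (@le_trans _ _ ((2 ^+ m)^-1 ^+ p)).
    have h1 : 0 <= (2 ^+ m)^-1 :> R by rewrite invr_ge0 exprn_ge0.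
    have h2 : 0 <= wide_const c_m c_M / (a0%:R * 2 ^+ m).
      by rewrite divr_ge0// mulr_ge0 ?exprn_ge0// ltW.
    by rewrite lerXn2r.
  rewrite -exprS -exprM mulnC exprM -(exprVn (2 ^+ m)).
  apply: ler_wiXn2l => //.
  by rewrite invf_le1 ?exprn_gt0// exprn_ege1// ler1n.
- move=> m w nE; have [_ _ /(_ w nE) h] := EP m.
  set a := (a0 * 2 ^ m)%N in h; have aR : 1 <= a%:R :> R.
    by rewrite ler1n muln_gt0 a00 expn_gt0.
  have aq : 0 <= a%:R ^+ q :> R by rewrite exprn_ge0.
  apply: (le_trans ((ler_poweR_condition_number _ _ r0).2 h)); first by rewrite mulr_ge0.
  rewrite lee_fin powRM// -mulrA ler_wpM2l ?powR_ge0//.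
  rewrite (_ : (a%:R ^+ q) `^ r = a%:R `^ (q%:R * r)); last by rewrite powRrM powR_mulrn.
  apply: (le_trans (ler_powR aR qrs)).
  by rewrite powR_mulrn// /a natrM natrX exprMn -!exprM mulnC.
Qed.

End WideMoment.

(** * Both limits of the aspect ratio *)

Section Asymptotics.
Context {R : realType}.

Lemma absrB_nat (p n : nat) : ((p - n) + (n - p))%N%:R = `|p%:R - n%:R| :> R.
Proof.
have [np|/ltnW pn] := leqP n p.
  by rewrite (eqP np) addn0 natrB// ger0_norm// subr_ge0 ler_nat.
by rewrite (eqP pn) add0n natrB// distrC ger0_norm// subr_ge0 ler_nat.
Qed.

End Asymptotics.

Theorem lemma2p1 (R : realType) (c_m c_M : R) (p : nat -> nat)
    (d : nat -> measure_display) (T : forall n, measurableType (d n))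
    (P : forall n, probability (T n) R)
    (Sigma : forall n, 'M[R]_(p n)) (X : forall n, T n -> 'M[R]_(n, p n))
    (hc : 0 < c_m <= c_M)
    (hp : forall n, (0 < n)%N -> (0 < p n)%N)
    (hsym : forall n, (0 < n)%N -> Sigma n \is symmetricmx)
    (hSigma :
      [/\ (c_m%:E <= ereal_inf
            [set (lambda_min (Sigma n))%:E | n in [set n | (0 < n)%N]])%E,
          (ereal_inf [set (lambda_min (Sigma n))%:E | n in [set n | (0 < n)%N]]
            <= ereal_sup
            [set (lambda_max (Sigma n))%:E | n in [set n | (0 < n)%N]])%E &
          (ereal_sup [set (lambda_max (Sigma n))%:E | n in [set n | (0 < n)%N]]
            <= c_M%:E)%E])
    (hX : forall n, (0 < n)%N -> iid_normal_rows (P n) (X n) (Sigma n)) :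
  (forall gamma : R, 1 < gamma ->
     (fun n => (p n)%:R / n%:R : R) @ \oo --> gamma ->
     forall r : R, 0 <= r ->
       exists2 K : R, 0 < K &
         \forall n \near \oo,
           (\int[P n]_w (condition_number (X n w) `^ r) <= K%:E)%E)
  /\
  ((fun n => (p n)%:R / n%:R : R) @ \oo --> (1 : R) ->
     forall r : R, 0 < r ->
       (fun n => (\int[P n]_w (condition_number (X n w) `^ r))%E) @ \oo
         --> +oo%E).
Proof.
have /andP[cm0 cmM] := hc; have cM0 : 0 < c_M := lt_le_trans cm0 cmM.
have [hmin _ hmax] := hSigma.
have symS n : (0 < n)%N -> (Sigma n)^T = Sigma n.
  by move=> n0; have /is_hermitianmxP := hsym n n0; rewrite expr0 scale1r map_mx_id.
have Sge n : (0 < n)%N -> forall v, c_m * sqnorm v <= qform (Sigma n) v.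
  move=> n0 v; apply: le_trans (lambda_min_le_qform (symS n n0) (hp n n0) v).
  rewrite ler_wpM2r ?sqnorm_ge0// -lee_fin; apply: (le_trans hmin).
  by apply: ereal_inf_lbound; exists n.
have Sle n : (0 < n)%N -> forall v, qform (Sigma n) v <= c_M * sqnorm v.
  move=> n0 v; apply: (le_trans (qform_le_lambda_max (symS n n0) v)).
  rewrite ler_wpM2r ?sqnorm_ge0// -lee_fin; apply: (le_trans _ hmax).
  by apply: ereal_sup_ubound; exists n.
have coords n : (0 < n)%N ->
    exists (A : 'I_n -> 'M[R]_(p n)) (Z : 'I_n * 'I_(p n) -> {RV P n >-> R}),
    [/\ iid_normal Z, (forall i, (A i)^T *m A i = Sigma n) &
        X n = fun w => matrix_of_coords A (Z ^~ w)].
  move=> n0; have Su : Sigma n \in unitmx.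
    by rewrite unitmxE unitfE gt_eqF// (det_gt0 (symS n n0) cm0 (Sge n n0)).
  have [A [Z [iidZ AS XE]]] := iid_normal_rows_coords Su (hX n n0).
  exists A, Z; split => //; apply/funext => w; apply/row_matrixP => i.
  by rewrite XE /matrix_of_coords rowK.
split.
- move=> gamma g1 pg r r0.
  (* Eventually p >= g n, and then q >= 2 + 2 / (g - 1) ensures q (p - n) >= 2 p. *)
  pose g := (1 + gamma) / 2; have g1' : 1 < g by rewrite /g; lra.
  pose q := (Num.truncn (2 / (g - 1))).+3.
  pose s := (Num.truncn (q%:R * r)).+1.
  pose a0 := (Num.truncn (wide_const c_m c_M)).+1.
  exists (2 `^ r * a0%:R ^+ s * (1 + 4 * 2 ^+ s)).
    have h2 : 0 < 2 `^ r :> R by rewrite powR_gt0.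
    have h3 : 0 < a0%:R ^+ s :> R by rewrite exprn_gt0// ltr0n.
    have h4 : 0 <= 2 ^+ s :> R by rewrite exprn_ge0.
    by rewrite !mulr_gt0//; lra.
  near=> n.
  have n0 : (0 < n)%N by near: n; exact: nbhs_infty_gt.
  have nR : 0 < n%:R :> R by rewrite ltr0n.
  have pn : g * n%:R <= (p n)%:R.
    rewrite -ler_pdivlMr//; near: n.
    apply: (cvgr_ge gamma pg); rewrite /g; lra.
  have np : (n <= p n)%N.
    rewrite -(ler_nat R); apply: le_trans pn; rewrite ler_peMl//; exact: ltW.
  have sn : (s < n)%N by near: n; exact: nbhs_infty_gt.
  have [A [Z [iidZ AS ->]]] := coords n n0.
  apply: (wide_moment_le n0 np cm0 cM0 iidZ AS (symS n n0) (Sge n n0) (Sle n n0) r0 (q := q)) => //.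
  + by rewrite /s ltW// truncnS_gt.
  + exact: leq_trans sn np.
  + rewrite -(ler_nat R) !natrM natrB//.
    have hq : 2 / (g - 1) <= q%:R - 2.
      have -> : q%:R = (Num.truncn (2 / (g - 1))).+1%:R + 2 :> R.
        by rewrite -natrD addn2.
      by rewrite addrK; exact/ltW/truncnS_gt.
    have g10 : 0 < g - 1 by rewrite subr_gt0.
    rewrite ler_pdivrMr// in hq.
    have h1 := ler_wpM2r (ltW nR) hq.
    have q2 : 0 <= q%:R - 2 :> R by rewrite subr_ge0 ler_nat.
    have h5 : (q%:R - 2) * ((g - 1) * n%:R) <= (q%:R - 2) * ((p n)%:R - n%:R).
      by rewrite ler_wpM2l//; lra.
    move: h1 h5; rewrite mulrA; lra.
  + exact/ltW/truncnS_gt.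
- move=> p1 r r0.
  apply/cvgeyPge => M.
  pose B := Num.max M 1; have B1 : 1 <= B by rewrite le_max lexx orbT.
  have B0 : 0 < B by apply: lt_le_trans B1.
  pose t := (2 * B) `^ r^-1; have t0 : 0 < t by rewrite powR_gt0// mulr_gt0.
  (* L = e n is small enough for t^2 L <= c_m p / 64 once p >= n / 2, and
     |p - n| + 2 <= 2 h n is small enough for s_min_tail to give 1/4. *)
  pose e := c_m / (2 * 64 * t ^+ 2).
  have e0 : 0 < e by rewrite divr_gt0// !mulr_gt0// exprn_gt0.
  pose h := e / (2 * 64 * c_M); have h0 : 0 < h by rewrite divr_gt0// !mulr_gt0.
  have pd := cvgr_dist_le _ _ p1 _ h0.
  near=> n.
  have n0 : (0 < n)%N by near: n; exact: nbhs_infty_gt.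
  have nR : 0 < n%:R :> R by rewrite ltr0n.
  have pge : 1 / 2 * n%:R <= (p n)%:R :> R.
    rewrite -(ler_pdivlMr _ _ nR); near: n; apply: (cvgr_ge 1 p1); lra.
  have pdist : `|(p n)%:R - n%:R| <= h * n%:R.
    rewrite -ler_pdivrMr// -[X in _ / X](gtr0_norm nR) -normf_div mulrBl mulfV ?gt_eqF//.
    rewrite distrC; near: n; exact: pd.
  have nh : 2 <= h * n%:R.
    rewrite mulrC -ler_pdivrMr//; near: n; exact: nbhs_infty_ger.
  have [A [Z [iidZ AS ->]]] := coords n n0.
  have MB : M <= t `^ r / 2.
    rewrite /t -powRrM mulVf ?gt_eqF// powRr1; last by rewrite mulr_ge0// ltW.
    by rewrite mulrC mulrA mulVf// mul1r le_max lexx.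
  apply: (@le_trans _ _ (t `^ r / 2)%:E); first by rewrite lee_fin.
  apply: (critical_moment_ge n0 (hp n n0) cm0 cM0 iidZ AS (symS n n0) (Sge n n0) (Sle n n0)
    (L := e * n%:R)) => //.
  + by rewrite mulr_gt0.
  + exact: ltW.
  + have -> : t ^+ 2 * (e * n%:R) = c_m / 64 * (1 / 2 * n%:R).
      by rewrite /e; field; rewrite gt_eqF.
    by rewrite ler_wpM2l// divr_ge0// ltW.
  + rewrite ler_pdivrMr; last by rewrite mulr_gt0.
    have -> : (p n - n + (n - p n) + 2)%:R = `|(p n)%:R - n%:R| + 2 :> R.
      by rewrite natrD absrB_nat.
    have -> : 1 / 4 * (e * n%:R) = 16 * c_M * (2 * (h * n%:R)).
      by rewrite /h; field; rewrite gt_eqF.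
    by rewrite ler_wpM2l ?mulr_ge0 ?(ltW cM0)//; lra.
Unshelve. all: by end_near. Qed.
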